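(* Let $T$ be an object of $\mathbf\Omega^\circ_r$. For the representable functor $\mathbf\Omega^\circ_r(-,T)$, $$DH_p(\mathbb Z\,\mathbf\Omega^\circ_r(-,T))=\begin{cases}\displaystyle\bigoplus_{v\in Vert(T)}\mathbb Z[\Sigma_{inputs(v)}]&\text{if }p=-1,\\ 0&\text{otherwise,}\end{cases}$$ where $Vert(T)$ is the set of vertices of $T$ and $\Sigma_{inputs(v)}$ is the symmetric group on the set of inputs of $v$.
   Context: **Trees.** $\mathbf\Omega$ is the Moerdijk–Weiss category of finite rooted trees (morphisms are maps of the associated free symmetric coloured operads). $\mathbf\Omega^\circ_r\subset\mathbf\Omega$ is the full subcategory on trees all of whose vertices have at least $2$ inputs. $\mathbb A\subset\mathbf\Omega^\circ_r$ is the subcategory with the same objects and with morphisms $S\to T$ those which preserve the root and induce a bijection between the leaves; equivalently, an isomorphism of $S$ with a tree obtained from $T$ by contracting some inner edges. For an inner edge $e$ of $T$, $\partial_e:\partial_eT\to T$ is the morphism of $\mathbb A$ contracting $e$. $C_\ell$ is the corolla with $\ell$ leaves. **Dendroidal homology.** For a presheaf $M$ of abelian groups on $\mathbb A$ (a presheaf on $\mathbf\Omega^\circ_r$ is restricted to $\mathbb A$), $\ell\ge 2$ and $p\ge-1$, $DC_p(M)^{(\ell)}$ is the quotient of $\bigoplus_{(T,\alpha,e)}M(T)$, over trees $T$ with at least one vertex and exactly $p+1$ inner edges, morphisms $\alpha:C_\ell\to T$ in $\mathbb A$, and enumerations $e=(e_0,\dots,e_p)$ of the inner edges of $T$, by the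 relations $(T,\alpha,e,\theta^*x')=(T',\theta\alpha,\theta e,x')$ for isomorphisms $\theta:T\to T'$ and $x'\in M(T')$, and $(T,\alpha,e,x)=\mathrm{sgn}(\tau)(T,\alpha,e\tau,x)$ for permutations $\tau$ of $\{0,\dots,p\}$. $\Sigma_\ell=Aut(C_\ell)$ acts by precomposition on $\alpha$. The differential is $$\partial(T,\alpha,e,x)=\sum_{i=0}^p(-1)^i(\partial_{e_i}T,\partial_{e_i}^*(\alpha),(e_0,\dots,\widehat{e_i},\dots,e_p),\partial_{e_i}^*x),$$ where $\partial_{e_i}^*(\alpha)$ is the unique morphism with $\partial_{e_i}\circ\partial_{e_i}^*(\alpha)=\alpha$. $DH_p(M)$ is the homology in degree $p$ of $DC_*(M)$, a symmetric sequence with $\ell$-th component $DH_p^{(\ell)}(M)=H_p(DC_*(M)^{(\ell)})$; one also writes $DH_p(M)=\bigoplus_{\ell\ge2}DH_p^{(\ell)}(M)$. A summand $\mathbb Z[\Sigma_{inputs(v)}]$ for a vertex $v$ with $\ell$ inputs lies in the component $\ell$. $\mathbb Z F$ is the free abelian group on a presheaf of sets $F$. *)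

(* Defs.v *)
Set Warnings "-notation-overridden,-redundant-canonical-projection,-projection-no-head-constant,-ambiguous-paths,-notation-incompatible-prefix".
From HB Require Import structures.
From mathcomp Require Import all_boot all_order all_fingroup all_algebra finmap.
From mathcomp Require Import boolp classical_sets cardinality fsbigop.

Set Implicit Arguments.
Unset Strict Implicit.
Unset Printing Implicit Defensive.

Import GRing.Theory.
Local Open Scope ring_scope.

Record dsum (I : choiceType) (M : I -> zmodType) := DSum {
  dsum_fun :> forall i, M i;
  dsum_fin : finite_set [set i | dsum_fun i != 0]%classic
}.

HB.instance Definition _ (I : choiceType) (M : I -> zmodType) :=
  gen_eqMixin (dsum M).
HB.instance Definition _ (I : choiceType) (M : I -> zmodType) :=
  gen_choiceMixin (dsum M).

Section DirectSum.
Variables (I : choiceType) (M : I -> zmodType).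
Implicit Types f g h : dsum M.

Lemma dsumP f g : (forall i, f i = g i) -> f = g.
Proof.
case: f g => [f ff] [g fg] /= fgE.
have E : f = g by apply: functional_extensionality_dep.
by case: _ / E in fg *; congr DSum; apply: Prop_irrelevance.
Qed.

Lemma dsum0_fin : finite_set [set i | (0 : M i) != 0]%classic.
Proof.
by rewrite (_ : mkset _ = set0) // -subset0 => i /=; rewrite eqxx.
Qed.
Definition dsum0 := DSum dsum0_fin.

Lemma dsum_opp_fin f : finite_set [set i | - f i != 0]%classic.
Proof.
by apply: sub_finite_set (dsum_fin f) => i /=; rewrite oppr_eq0.
Qed.
Definition dsum_opp f := DSum (dsum_opp_fin f).

Lemma dsum_add_fin f g : finite_set [set i | f i + g i != 0]%classic.
Proof.
have /(sub_finite_set _) : finite_set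
    ([set i | f i != 0] `|` [set i | g i != 0])%classic.
  by rewrite finite_setU; split; apply: dsum_fin.
apply => i /= fgi; have [fi|fi] := eqVneq (f i) 0; last by left.
by right; apply: contra_neq fgi => ->; rewrite fi addr0.
Qed.
Definition dsum_add f g := DSum (dsum_add_fin f g).

Lemma dsum_addA : associative dsum_add.
Proof. by move=> f g h; apply: dsumP => i /=; rewrite addrA. Qed.
Lemma dsum_addC : commutative dsum_add.
Proof. by move=> f g; apply: dsumP => i /=; rewrite addrC. Qed.
Lemma dsum_add0 : left_id dsum0 dsum_add.
Proof. by move=> f; apply: dsumP => i /=; rewrite add0r. Qed.
Lemma dsum_addN : left_inverse dsum0 dsum_opp dsum_add.
Proof. by move=> f; apply: dsumP => i /=; rewrite addNr. Qed.

HB.instance Definition _ := GRing.isZmodule.Build (dsum M)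
  dsum_addA dsum_addC dsum_add0 dsum_addN.

Lemma dsum_inj_fin i (x : M i) :
  finite_set [set j | dfwith (fun j => 0 : M j) x j != 0]%classic.
Proof.
apply: sub_finite_set (finite_set1 i) => j /=.
by case: dfwithP => // k _; rewrite eqxx.
Qed.
Definition dsum_inj i (x : M i) : dsum M := DSum (dsum_inj_fin x).

Lemma dsum_inj_zmod i : zmod_morphism (@dsum_inj i).
Proof.
move=> x y; apply: dsumP => j /=; rewrite {1}/dfwith.
case: eqP => [ij|ij]; first by case: _ / ij; rewrite !dfwith_in.
by rewrite !dfwith_out ?subr0 //; apply/eqP.
Qed.
HB.instance Definition _ i :=
  GRing.isZmodMorphism.Build (M i) (dsum M) (@dsum_inj i) (@dsum_inj_zmod i).

Section Lift.
Variables (W : zmodType) (F : forall i, M i -> W).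

Definition dsum_lift (f : dsum M) : W := \sum_(i \in [set: I]) F (f i).

Hypothesis F_zmod : forall i, zmod_morphism (@F i).

Let F0 i : F (0 : M i) = 0.
Proof. by have := F_zmod (0 : M i) 0; rewrite !subrr. Qed.

Lemma dsum_lift_zmod : zmod_morphism dsum_lift.
Proof.
move=> f g.
have /finite_fsetP [X XE] : finite_set
    ([set i | f i != 0] `|` [set i | g i != 0])%classic.
  by rewrite finite_setU; split; apply: dsum_fin.
have fX i : i \notin X -> f i = 0.
  move=> iX; apply/eqP; apply: contraNT iX => fi.
  suff: [set` X]%classic i by [].
  by rewrite -XE; left.
have gX i : i \notin X -> g i = 0.
  move=> iX; apply/eqP; apply: contraNT iX => gi.
  suff: [set` X]%classic i by [].
  by rewrite -XE; right.
rewrite /dsum_lift !(@fsbigTE _ _ _ _ X) /= => [|i /gX ->|i /fX ->|i iX].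
- by rewrite -sumrB; apply: eq_bigr => i _; apply: F_zmod.
- exact: F0.
- exact: F0.
- by rewrite fX // gX // subrr F0.
Qed.

Lemma dsum_lift_inj i (x : M i) : dsum_lift (dsum_inj x) = F x.
Proof.
rewrite /dsum_lift (@fsbigTE _ _ _ _ [fset i]%fset) /=.
  by rewrite big_seq_fset1 dfwith_in.
move=> j; rewrite inE eq_sym => ij.
by rewrite dfwith_out // F0.
Qed.

End Lift.

Lemma dsum_sum f : f = \sum_(i \in [set: I]) dsum_inj (f i).
Proof.
have /finite_fsetP [X XE] := dsum_fin f.
have fX i : i \notin X -> f i = 0.
  move=> iX; apply/eqP; apply: contraNT iX => fi.
  suff: [set` X]%classic i by [].
  by rewrite -XE.
rewrite (@fsbigTE _ _ _ _ X) /=; last by move=> i /fX ->; rewrite raddf0.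
apply: dsumP => j.
have ev : {morph (fun h : dsum M => h j) : a b / a + b >-> a + b} by [].
rewrite (big_morph (fun h : dsum M => h j) ev (erefl _)).
have [jX|jX] := boolP (j \in X).
  rewrite (big_fsetD1 j) //= dfwith_in big_seq big1 ?addr0 // => i.
  by rewrite !inE => /andP[ij _]; rewrite dfwith_out.
rewrite big_seq big1 ?fX // => i iX; rewrite /= dfwith_out //.
by apply: contraNneq jX => <-.
Qed.

Lemma dsum_ind (P : dsum M -> Prop) : P 0 ->
  (forall f g, P f -> P g -> P (f + g)) ->
  (forall i (x : M i), P (dsum_inj x)) -> forall f, P f.
Proof.
move=> P0 PD Pi f; rewrite (dsum_sum f).
by elim/big_ind: _ => [|a b /PD|i _]; [|apply|apply: Pi].
Qed.

End DirectSum.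

Definition freeab (X : choiceType) : zmodType := dsum (fun _ : X => int).
Definition freeab_gen (X : choiceType) (x : X) : freeab X :=
  @dsum_inj X (fun _ => int) x 1.

Section Quotient.
Variable V : zmodType.
Implicit Type R : V -> Prop.

Definition gen_subgroup R : {pred V} :=
  [pred x | `[< forall S : zmodClosed V, (forall r, R r -> r \in S) -> x \in S >]].

Lemma gen_subgroup_zmod R : zmod_closed (gen_subgroup R).
Proof.
split=> [|x y /asboolP Sx /asboolP Sy]; apply/asboolP => S RS.
  exact: rpred0.
by rewrite rpredB ?Sx ?Sy.
Qed.
HB.instance Definition _ R :=
  GRing.isZmodClosed.Build V (gen_subgroup R) (gen_subgroup_zmod R).

(** Quotient of [V] by the subgroup generated by [R]. *)
Definition gquot R : zmodType := Quotient.quot (gen_subgroup R : zmodClosed V).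
Definition quot_pi R (x : V) : gquot R := \pi_(gquot R)%qT x.

Lemma quot_pi_zmod R : zmod_morphism (quot_pi R).
Proof. by move=> x y; rewrite /quot_pi raddfB. Qed.
HB.instance Definition _ R :=
  GRing.isZmodMorphism.Build V (gquot R) (quot_pi R) (quot_pi_zmod R).

Lemma quot_piP R (q : gquot R) : exists x, q = quot_pi R x.
Proof. by exists (generic_quotient.repr q); rewrite /quot_pi reprK. Qed.

Lemma quot_pi_rel R x : R x -> quot_pi R x = 0.
Proof.
move=> Rx; rewrite -(raddf0 (quot_pi R)); apply/eqP.
rewrite /quot_pi -Quotient.idealrBE subr0; apply/asboolP => S; exact.
Qed.

Section Lift.
Variables (R : V -> Prop) (W : zmodType) (F : {additive V -> W}).

Lemma gen_subgroup_ker x :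
  (forall r, R r -> F r = 0) -> x \in gen_subgroup R -> F x = 0.
Proof.
move=> FR; pose K : {pred V} := [pred x | F x == 0].
have Kz : zmod_closed K.
  split=> [|a b]; rewrite !inE ?raddf0 // => /eqP Fa /eqP Fb.
  by rewrite raddfB Fa Fb subrr.
pose mK := GRing.isZmodClosed.Build V K Kz.
pose KS : zmodClosed V := HB.pack K mK.
move=> /asboolP /(_ KS) H; apply/eqP; apply: H => r Rr.
by rewrite inE FR.
Qed.

Definition quot_lift (q : gquot R) : W := F (generic_quotient.repr q).

Hypothesis FR : forall r, R r -> F r = 0.

Lemma quot_lift_pi x : quot_lift (quot_pi R x) = F x.
Proof.
apply/eqP; rewrite -subr_eq0 -raddfB; apply/eqP/gen_subgroup_ker => //.
by rewrite Quotient.idealrBE reprK.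
Qed.

Lemma quot_lift_zmod : zmod_morphism quot_lift.
Proof.
move=> q r; case: (quot_piP q) (quot_piP r) => x -> [y ->].
by rewrite -raddfB !quot_lift_pi raddfB.
Qed.

End Lift.
End Quotient.

Section Kernel.
Variables (B C : zmodType) (d : {additive B -> C}).

Definition dkernel : {pred B} := [pred x | d x == 0].
Lemma kernel_zmod : zmod_closed dkernel.
Proof.
split=> [|x y]; rewrite !inE ?raddf0 // => /eqP dx /eqP dy.
by rewrite raddfB dx dy subrr.
Qed.
HB.instance Definition _ := GRing.isZmodClosed.Build B dkernel kernel_zmod.

Record cycles := Cycle { cycle_val : B; _ : cycle_val \in dkernel }.
HB.instance Definition _ := [isSub for cycle_val].
HB.instance Definition _ := [Choice of cycles by <:].
HB.instance Definition _ := [SubChoice_isSubZmodule of cycles by <:].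
End Kernel.

(** Homology at [B] of [A --d1--> B --d0--> C]. *)
Definition homology_at (A B C : zmodType)
    (d1 : {additive A -> B}) (d0 : {additive B -> C}) : zmodType :=
  gquot (fun z : cycles d0 => exists y, d1 y = cycle_val z).

Record category := Category {
  obj :> Type;
  mor : obj -> obj -> choiceType;
  idmor : forall a, mor a a;
  mcomp : forall a b d, mor b d -> mor a b -> mor a d;
  comp1m : forall a b (f : mor a b), mcomp (idmor b) f = f;
  compm1 : forall a b (f : mor a b), mcomp f (idmor a) = f;
  compA : forall a b d e (h : mor d e) (g : mor b d) (f : mor a b),
    mcomp h (mcomp g f) = mcomp (mcomp h g) f
}.
Arguments mor {c}.
Arguments idmor {c}.
Arguments mcomp {c a b d}.

Definition is_iso (C : category) (a b : C) (f : mor a b) : Prop :=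
  exists g : mor b a, mcomp g f = idmor a /\ mcomp f g = idmor b.

Record set_presheaf (C : category) := SetPresheaf {
  sp_obj :> C -> choiceType;
  sp_map : forall a b, mor a b -> sp_obj b -> sp_obj a;
  sp_map1 : forall a (x : sp_obj a), sp_map (idmor a) x = x;
  sp_mapM : forall a b c (g : mor b c) (f : mor a b) (x : sp_obj c),
    sp_map (mcomp g f) x = sp_map f (sp_map g x)
}.

Record ab_presheaf (C : category) := AbPresheaf {
  ap_obj :> C -> zmodType;
  ap_map : forall a b, mor a b -> {additive ap_obj b -> ap_obj a};
  ap_map1 : forall a (x : ap_obj a), ap_map (idmor a) x = x;
  ap_mapM : forall a b c (g : mor b c) (f : mor a b) (x : ap_obj c),
    ap_map (mcomp g f) x = ap_map f (ap_map g x)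
}.

Definition representable (C : category) (c : C) : set_presheaf C :=
  @SetPresheaf C (fun a => mor a c) (fun a b f g => mcomp g f)
    (fun a x => compm1 x) (fun a b d g f x => compA x g f).

Section FreePresheaf.
Variables (C : category) (F : set_presheaf C).

Definition free_map (a b : C) (f : mor a b) : freeab (F b) -> freeab (F a) :=
  dsum_lift (fun x n => freeab_gen (sp_map f x) *~ n).

Lemma free_map_zmod a b (f : mor a b) : zmod_morphism (free_map f).
Proof. by apply: dsum_lift_zmod => x m n; rewrite mulrzBr. Qed.
HB.instance Definition _ a b (f : mor a b) :=
  GRing.isZmodMorphism.Build (freeab (F b)) (freeab (F a)) (free_map f)
    (free_map_zmod f).

Lemma freeab_genE (X : choiceType) (x : X) (n : int) :
  @dsum_inj X (fun _ => int) x n = freeab_gen x *~ n.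
Proof. by rewrite /freeab_gen -raddfMz /= intz. Qed.

Lemma free_map_gen a b (f : mor a b) (x : F b) :
  free_map f (freeab_gen x) = freeab_gen (sp_map f x).
Proof.
rewrite /free_map dsum_lift_inj ?mulr1z // => y m n.
by rewrite mulrzBr.
Qed.

Lemma free_map1 a (u : freeab (F a)) : free_map (idmor a) u = u.
Proof.
elim/dsum_ind: u => [|u v IHu IHv|x n]; first exact: raddf0.
  by rewrite raddfD /= IHu IHv.
by rewrite freeab_genE raddfMz /= free_map_gen sp_map1.
Qed.

Lemma free_mapM a b c (g : mor b c) (f : mor a b) (u : freeab (F c)) :
  free_map (mcomp g f) u = free_map f (free_map g u).
Proof.
elim/dsum_ind: u => [|u v IHu IHv|x n]; first by rewrite !raddf0.
  by rewrite !raddfD /= IHu IHv.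
by rewrite freeab_genE !raddfMz /= !free_map_gen sp_mapM.
Qed.

Definition free_presheaf : ab_presheaf C :=
  @AbPresheaf C (fun a => freeab (F a)) (fun a b f => free_map f)
    free_map1 free_mapM.

End FreePresheaf.

Local Open Scope nat_scope.
Local Open Scope fset_scope.

(** A finite rooted tree whose edges are labelled by natural numbers.  A vertex
is named after its outgoing edge: [vert] is the set of edges that are the output
of a vertex (the other edges are the leaves), and [below e] is the vertex of
which the edge [e] is an input (irrelevant if [e] is the root or not an edge).
Labelling the edges by numbers makes the trees a small collection containing
every finite rooted tree up to isomorphism. *)
Record tree := Tree {
  edges : {fset nat};
  vert : {fset nat};
  troot : nat;
  below : nat -> nat;
  root_edge : troot \in edges;
  vert_edge : {subset vert <= edges};
  below_vert : forall e, e \in edges -> e != troot -> below e \in vert;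
  to_root : forall e, e \in edges -> exists k, iter k below e = troot
}.

Definition inputs (T : tree) (v : nat) : {fset nat} :=
  [fset e in edges T | (e != troot T) && (below T e == v)].
Definition leaves (T : tree) : {fset nat} := edges T `\` vert T.
Definition inner (T : tree) : {fset nat} := vert T `\ troot T.

Definition reduced (T : tree) : Prop :=
  forall v, v \in vert T -> 2 <= #|` inputs T v|.

(** [tree_op T [:: e_1; ...; e_n] e]: the free symmetric coloured operad on [T],
whose colours are the edges, has an operation from [e_1, ..., e_n] to [e].  The
operations are generated by the vertices under units, symmetries and partial
compositions.  In the operad of a tree there is at most one operation of each
signature, so that only its existence has to be recorded. *)
Inductive tree_op (T : tree) : seq nat -> nat -> Prop :=
| op_unit e of e \in edges T : tree_op T [:: e] e
| op_vertex v of v \in vert T : tree_op T (inputs T v) v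
| op_perm s t e of perm_eq s t & tree_op T s e : tree_op T t e
| op_comp s1 x s2 t e of tree_op T (s1 ++ x :: s2) e & tree_op T t x :
    tree_op T (s1 ++ t ++ s2) e.

(** The action of [f] on labels; junk outside [edges S]. *)
Definition on_edges (S T : tree) (f : {ffun edges S -> edges T}) (x : nat) : nat :=
  if insub x is Some y then val (f y) else x.

Definition preserves_op (S T : tree) (f : {ffun edges S -> edges T}) : Prop :=
  forall s e, tree_op S s e -> tree_op T (map (on_edges f) s) (on_edges f e).

Record tree_hom (S T : tree) := TreeHom {
  edge_map :> {ffun edges S -> edges T};
  _ : `[< preserves_op edge_map >]
}.
HB.instance Definition _ S T := [isSub for @edge_map S T].
HB.instance Definition _ S T := [Finite of tree_hom S T by <:].

Section TreeLemmas.
Variable T : tree.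

Lemma below_neq e : e \in edges T -> e != troot T -> below T e != e.
Proof.
move=> eT er; apply: contra_neq er => be; have [k <-] := to_root eT.
by elim: k => //= k <-.
Qed.

Lemma inputsP v x :
  (x \in inputs T v) = [&& x \in edges T, x != troot T & below T x == v].
Proof. by rewrite !inE. Qed.

Lemma innerP e : (e \in inner T) = (e != troot T) && (e \in vert T).
Proof. by rewrite !inE. Qed.

Lemma inner_edge e : e \in inner T -> e \in edges T.
Proof. by rewrite innerP => /andP[_]; exact: vert_edge. Qed.

Lemma inputs_self v : v \notin inputs T v.
Proof.
rewrite inputsP; apply/and3P => -[vT vr]; apply/negP; exact: below_neq.
Qed.

Lemma op_edges s e : tree_op T s e -> (e \in edges T) /\ {subset s <= edges T}.
Proof.
elim=> {s e} [e eT|v vT|s t e st _ [eT sT]|s1 x s2 t e _ [eT s12] _ [xT tT]].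
- by split=> // x; rewrite inE => /eqP ->.
- split; first exact: vert_edge.
  by move=> x; rewrite inputsP => /and3P[].
- by split=> // x; rewrite -(perm_mem st); exact: sT.
- split=> // y; rewrite !mem_cat => /or3P[ys|/tT //|ys]; apply: s12.
    by rewrite mem_cat ys.
  by rewrite mem_cat inE ys !orbT.
Qed.

End TreeLemmas.

Section TreeHom.
Variables S T : tree.
Implicit Types f g : tree_hom S T.

Lemma app_edge (f : {ffun edges S -> edges T}) x :
  x \in edges S -> on_edges f x \in edges T.
Proof. by move=> xS; rewrite /on_edges insubT; apply: valP. Qed.

Lemma app_val (f : {ffun edges S -> edges T}) (x : edges S) :
  on_edges f (val x) = val (f x).
Proof. by rewrite /on_edges valK. Qed.

Lemma tree_homP f g :
  (forall x, x \in edges S -> on_edges f x = on_edges g x) -> f = g.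
Proof.
move=> fg; apply/val_inj/ffunP => x; apply: val_inj.
by rewrite -!app_val fg //; exact: valP.
Qed.

Lemma tree_hom_op f s e :
  tree_op S s e -> tree_op T (map (on_edges f) s) (on_edges f e).
Proof. by case: f => f /= /asboolP; apply. Qed.

End TreeHom.

Lemma preserves_vertex S T (f : {ffun edges S -> edges T}) :
  (forall v, v \in vert S -> tree_op T (map (on_edges f) (inputs S v)) (on_edges f v)) ->
  preserves_op f.
Proof.
move=> fv s e; elim=> {s e} [e eS|v /fv //|s t e st _|s1 x s2 t e _ + _].
- by apply: op_unit; exact: app_edge.
- by apply: op_perm; exact: perm_map.
- rewrite !map_cat; exact: op_comp.
Qed.

Section TreeId.
Variable T : tree.
Let f := [ffun x : edges T => x].
Lemma app_id x : on_edges f x = x.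
Proof. by rewrite /on_edges; case: insubP => // y _ <-; rewrite ffunE. Qed.
Lemma tree_id_op : `[< preserves_op f >].
Proof.
by apply/asboolP => s e; rewrite app_id (eq_map app_id) map_id.
Qed.
Definition tree_id : tree_hom T T := TreeHom tree_id_op.
End TreeId.

Section TreeComp.
Variables (S T U : tree) (g : tree_hom T U) (f : tree_hom S T).
Let gf := [ffun x : edges S => g (f x)].
Lemma app_comp x : x \in edges S -> on_edges gf x = on_edges g (on_edges f x).
Proof.
by move=> xS; rewrite -[x]/(val [` xS]) !app_val ffunE.
Qed.
Lemma tree_comp_op : `[< preserves_op gf >].
Proof.
apply/asboolP => s e ose; have [eS sS] := op_edges ose.
rewrite app_comp // (eq_in_map (on_edges gf) (on_edges g \o on_edges f) s).1.
  by rewrite map_comp; do 2!apply: tree_hom_op.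
by move=> x /sS; exact: app_comp.
Qed.
Definition tree_comp : tree_hom S U := TreeHom tree_comp_op.
End TreeComp.

Record rtree := RTree { rtree_tree :> tree; rtree_reduced : reduced rtree_tree }.

Lemma tree_comp1m S T (f : tree_hom S T) : tree_comp (tree_id T) f = f.
Proof. by apply: tree_homP => x xS; rewrite app_comp // app_id. Qed.
Lemma tree_compm1 S T (f : tree_hom S T) : tree_comp f (tree_id S) = f.
Proof. by apply: tree_homP => x xS; rewrite app_comp // app_id. Qed.
Lemma tree_compA S T U V (h : tree_hom U V) (g : tree_hom T U) (f : tree_hom S T) :
  tree_comp h (tree_comp g f) = tree_comp (tree_comp h g) f.
Proof. by apply: tree_homP => x xS; rewrite !app_comp // app_edge. Qed.

Definition Omega_r : category :=
  @Category rtree (fun S T => tree_hom S T : choiceType) (fun T => tree_id T)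
    (fun S T U => @tree_comp S T U)
    (fun S T => @tree_comp1m S T) (fun S T => @tree_compm1 S T)
    (fun S T U V => @tree_compA S T U V).

Definition root_leaves (S T : tree) (f : tree_hom S T) : Prop :=
  [/\ on_edges f (troot S) = troot T,
      {in leaves S, forall x, on_edges f x \in leaves T},
      {in leaves S &, injective (on_edges f)} &
      {in leaves T, forall y, exists2 x, x \in leaves S & on_edges f x = y}].

Record A_hom (S T : tree) := AHom {
  A_tree_hom :> tree_hom S T;
  _ : `[< root_leaves A_tree_hom >]
}.
HB.instance Definition _ S T := [isSub for @A_tree_hom S T].
HB.instance Definition _ S T := [Finite of A_hom S T by <:].

Lemma A_homP S T (f g : A_hom S T) :
  (forall x, x \in edges S -> on_edges f x = on_edges g x) -> f = g.
Proof. by move=> fg; apply/val_inj/tree_homP. Qed.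

Lemma leaf_edge T x : x \in leaves T -> x \in edges T.
Proof. by rewrite inE => /andP[]. Qed.

Lemma A_id_subproof T : `[< root_leaves (tree_id T) >].
Proof.
apply/asboolP; split=> [|x|x y _ _|y yT]; rewrite ?app_id //.
by exists y; rewrite ?app_id.
Qed.
Definition A_id T : A_hom T T := AHom (A_id_subproof T).

Lemma A_comp_subproof S T U (g : A_hom T U) (f : A_hom S T) :
  `[< root_leaves (tree_comp g f) >].
Proof.
case: g f => [g /= /asboolP[gr gl gi gs]] [f /= /asboolP[fr fl fi fs]].
apply/asboolP; split => [|x xS|x y xS yS|z /gs[y /fs[x xS <-] <-]].
- by rewrite app_comp ?fr ?root_edge.
- by rewrite app_comp ?leaf_edge // gl // fl.
- by rewrite !app_comp ?leaf_edge // => /gi-/(_ (fl _ xS) (fl _ yS))/fi; apply.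
- by exists x; rewrite // app_comp ?leaf_edge.
Qed.
Definition A_comp S T U (g : A_hom T U) (f : A_hom S T) : A_hom S U :=
  AHom (A_comp_subproof g f).

Lemma A_comp1m S T (f : A_hom S T) : A_comp (A_id T) f = f.
Proof. by apply/val_inj/tree_comp1m. Qed.
Lemma A_compm1 S T (f : A_hom S T) : A_comp f (A_id S) = f.
Proof. by apply/val_inj/tree_compm1. Qed.
Lemma A_compA S T U V (h : A_hom U V) (g : A_hom T U) (f : A_hom S T) :
  A_comp h (A_comp g f) = A_comp (A_comp h g) f.
Proof. by apply/val_inj/tree_compA. Qed.

Definition AA : category :=
  @Category rtree (fun S T => A_hom S T : choiceType) (fun T => A_id T)
    (fun S T U => @A_comp S T U)
    (fun S T => @A_comp1m S T) (fun S T => @A_compm1 S T)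
    (fun S T U V => @A_compA S T U V).

Definition restrict_A (M : ab_presheaf Omega_r) : ab_presheaf AA :=
  @AbPresheaf AA (fun T => M T)
    (fun S T (f : A_hom S T) => @ap_map _ M S T (A_tree_hom f))
    (fun T x => @ap_map1 _ M T x)
    (fun S T U (g : A_hom T U) (f : A_hom S T) x =>
       @ap_mapM _ M S T U (A_tree_hom g) (A_tree_hom f) x).

Section Contract.
Variables (T : tree) (e : nat).
Hypothesis eT : e \in inner T.

Let er : e != troot T. Proof. by move: eT; rewrite innerP => /andP[]. Qed.
Let ev : e \in vert T. Proof. by move: eT; rewrite innerP => /andP[]. Qed.
Let ee : e \in edges T. Proof. exact: vert_edge. Qed.

Definition contract_below (x : nat) : nat :=
  if below T x == e then below T e else below T x.

Lemma contract_root : troot T \in edges T `\ e.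
Proof. by rewrite !inE eq_sym er root_edge. Qed.
Lemma contract_vert : {subset vert T `\ e <= edges T `\ e}.
Proof. by move=> x; rewrite !inE => /andP[-> /vert_edge]. Qed.
Lemma contract_below_vert x :
  x \in edges T `\ e -> x != troot T -> contract_below x \in vert T `\ e.
Proof.
rewrite !inE /contract_below => /andP[xe xT] xr.
case: ifPn => [/eqP bx|bx]; first by rewrite below_neq // below_vert.
by rewrite bx below_vert.
Qed.
Lemma contract_to_root x :
  x \in edges T `\ e -> exists k, iter k contract_below x = troot T.
Proof.
rewrite !inE => /andP[+ xT]; have [k] := to_root xT.
elim/ltn_ind: k x xT => -[|k] IH x xT; first by exists 0.
have [xr|xr] := eqVneq x (troot T); first by exists 0.
rewrite iterSr => kx xe; have [bx|bx] := eqVneq (below T x) e.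
  case: k IH kx => [|k] IH; first by rewrite bx => /eqP; rewrite (negPf er).
  rewrite iterSr bx => kx.
  have [|||j jx] := IH k _ (below T e) _ kx; rewrite ?below_neq //.
    by rewrite vert_edge ?below_vert.
  by exists j.+1; rewrite iterSr {2}/contract_below bx eqxx.
have [|||j jx] := IH k _ (below T x) _ kx => //.
  by rewrite vert_edge ?below_vert.
by exists j.+1; rewrite iterSr {2}/contract_below (negPf bx).
Qed.

Definition contract : tree :=
  Tree contract_root contract_vert contract_below_vert contract_to_root.

Let R (s : seq nat) : seq nat :=
  flatten [seq (if y == e then inputs T e : seq nat else [:: y]) | y <- s].

Let R_id s : e \notin s -> R s = s.
Proof.
rewrite /R; elim: s => //= y s IH; rewrite inE negb_or eq_sym => /andP[ye es].
by rewrite (negPf ye) /= IH.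
Qed.

Let R_cat s t : R (s ++ t) = R s ++ R t.
Proof. by rewrite /R map_cat flatten_cat. Qed.

Let R_perm s t : perm_eq s t -> perm_eq (R s) (R t).
Proof. by move=> st; apply/perm_flatten/perm_map. Qed.

Let R_inputs v : v \in vert contract ->
  perm_eq (R (inputs T v)) (inputs contract v).
Proof.
rewrite /= !inE => /andP[ve vT].
have [eI|eI] := boolP (e \in inputs T v); last first.
  rewrite R_id //; apply: uniq_perm; rewrite ?fset_uniq // => x.
  rewrite !inputsP /= !inE /contract_below.
  have [->|xe] /= := eqVneq x e.
    by move: eI; rewrite inputsP => /negPf.
  have [xT|//] := boolP (x \in edges T); have [//|xr] /= := eqVneq x (troot T).
  have [->|//] := eqVneq (below T x) e; rewrite eq_sym (negPf ve).
  by move: eI; rewrite inputsP ee er /= => /negPf ->.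
move: (eI); rewrite inputsP ee er /= => /eqP be.
rewrite (permPl (R_perm (perm_to_rem eI))) -cat1s R_cat.
rewrite [R [:: e]]/R /= eqxx cats0.
have eu : e \notin rem e (inputs T v) by rewrite mem_rem_uniqF ?fset_uniq.
rewrite R_id //; apply: uniq_perm; rewrite ?fset_uniq //.
  rewrite cat_uniq fset_uniq rem_uniq ?fset_uniq //= andbT.
  apply/hasPn => x; rewrite mem_rem_uniq ?fset_uniq // !inE => /and4P[_ _ _ /eqP].
  by move=> bx; rewrite bx (negPf ve) !andbF.
move=> x; rewrite mem_cat mem_rem_uniq ?fset_uniq // [in RHS]inputsP /= !inE /contract_below.
have [->|xe] /= := eqVneq x e.
  by rewrite (negPf (below_neq ee er)) !andbF.
have [xT|//] := boolP (x \in edges T); have [//|xr] /= := eqVneq x (troot T).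
have [->|] := eqVneq (below T x) e; last by [].
by rewrite be eqxx.
Qed.

Lemma op_contract_incl s x : tree_op contract s x -> tree_op T s x.
Proof.
have RT a t z : tree_op T (a ++ t) z -> tree_op T (a ++ R t) z.
  elim: t a => //= y t IH a; rewrite -cat1s R_cat.
  rewrite [R [:: y]]/R /= cats0; case: eqP => [->|_]; last first.
    by rewrite !catA => ?; apply: IH; rewrite -catA.
  move=> oa; rewrite catA; apply: IH; rewrite -catA.
  by apply: (op_comp (x := e)) => //; exact: op_vertex.
elim=> {s x} [x|v vT|s t x st _ o|s1 y s2 t x _ o1 _ o2].
- by rewrite /= !inE => /andP[_]; exact: op_unit.
- apply: op_perm (R_inputs vT) _; apply: (RT [::]); apply: op_vertex.
  by move: vT; rewrite /= inE => /andP[].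
- exact: op_perm st o.
- exact: op_comp o1 o2.
Qed.

Lemma op_contract s x : e \notin s -> x != e -> tree_op T s x -> tree_op contract s x.
Proof.
move=> es xe o.
have [xT _] := op_edges o.
suff: forall a b z, tree_op contract (a ++ R [:: x] ++ b) z ->
    tree_op contract (a ++ R s ++ b) z.
  move=> /(_ [::] [::] x); rewrite !cats0 /= !R_id //.
    by apply; apply: op_unit; rewrite /= !inE xe.
  by rewrite inE eq_sym.
elim: o {es xe xT} => {s x} [//|v vT|s t x st _ IH|s1 y s2 t x _ IH1 _ IH2] a b z o.
- have [ve|ve] := eqVneq v e.
    move: o; rewrite ve [R [:: e]]/R /= eqxx cats0 R_id //.
    exact: inputs_self.
  move: o; rewrite (R_id (s := [:: v])) ?inE 1?eq_sym //= => o.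
  have vT' : v \in vert contract by rewrite /= !inE ve.
  apply: op_perm (op_comp o (op_vertex vT')).
  by rewrite perm_cat2l perm_cat2r perm_sym R_inputs.
- apply: op_perm (IH _ _ _ o).
  by rewrite perm_cat2l perm_cat2r R_perm.
- have := IH1 _ _ _ o; rewrite -cat1s !R_cat -!catA => o'.
  have := IH2 (a ++ R s1) (R s2 ++ b) z; rewrite -!catA; exact.
Qed.

Lemma contract_reduced : reduced T -> reduced contract.
Proof.
move=> Tr v vT; move: (vT); rewrite /= !inE => /andP[ve vT'].
have /perm_size <- := R_inputs vT.
apply: leq_trans (Tr _ vT') _; rewrite /R size_flatten /shape -map_comp.
have : 2 <= #|` inputs T e| by exact: Tr.
move: (inputs T e) => I I2.
elim: (X in size X <= sumn (map _ X)) => //= y s IH.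
case: ifP => _; first exact: (leq_add (ltnW I2) IH).
exact: (leq_add (leqnn 1) IH).
Qed.

Let incl := [ffun x : edges contract => [` fsubsetP (fsubD1set _ _) _ (valP x)] : edges T].

Lemma app_incl x : on_edges incl x = x.
Proof. by rewrite /on_edges; case: insubP => //= y _ <-; rewrite ffunE. Qed.

Lemma incl_op : `[< preserves_op incl >].
Proof.
apply/asboolP => s x; rewrite app_incl (eq_map app_incl) map_id.
exact: op_contract_incl.
Qed.
Definition contract_hom : tree_hom contract T := TreeHom incl_op.

Lemma contract_leaves : leaves contract = leaves T.
Proof.
apply/fsetP => x; rewrite /leaves /= !inE.
by have [->|] //= := eqVneq x e; rewrite ev.
Qed.

Lemma contract_A : `[< root_leaves contract_hom >].
Proof.
apply/asboolP; split=> [|x|x y _ _|y yT]; rewrite ?app_incl //.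
  by rewrite contract_leaves.
by exists y; rewrite ?contract_leaves ?app_incl.
Qed.

Definition contract_A_hom : A_hom contract T := AHom contract_A.

Lemma app_contract x : on_edges contract_A_hom x = x.
Proof. exact: app_incl. Qed.

Lemma app_contract_comp S (f : A_hom S contract) x :
  x \in edges S -> on_edges (A_comp contract_A_hom f) x = on_edges f x.
Proof. by move=> xS; rewrite app_comp // app_incl. Qed.

Lemma contract_mono S (f g : A_hom S contract) :
  A_comp contract_A_hom f = A_comp contract_A_hom g -> f = g.
Proof.
move=> fg; apply: A_homP => x xS.
by rewrite -!app_contract_comp // fg.
Qed.

Lemma contract_factor S (f : A_hom S T) :
  (forall x, x \in edges S -> on_edges f x != e) ->
  exists! g : A_hom S contract, A_comp contract_A_hom g = f.
Proof.
move=> fe.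
have g0P (x : edges S) : val (f x) \in edges T `\ e.
  rewrite !inE -app_val fe; last exact: valP.
  by rewrite app_edge //; exact: valP.
pose g0 : {ffun edges S -> edges contract} := [ffun x => [` g0P x]].
have appg x : on_edges g0 x = on_edges f x.
  by rewrite /on_edges; case: insubP => // y _ _; rewrite ffunE.
have g1P : `[< preserves_op g0 >].
  apply/asboolP => s x o; have [xS sS] := op_edges o.
  rewrite appg (eq_map appg); apply: op_contract; last exact: tree_hom_op.
    by apply/mapP => -[y /sS /fe/eqP ye /esym].
  exact: fe.
pose g1 : tree_hom S contract := TreeHom g1P.
have g2P : `[< root_leaves g1 >].
  have /asboolP[fr fl fi fs] := valP f.
  apply/asboolP; split=> [|x xS|x y xS yS|y].
  - by rewrite appg.
  - by rewrite appg contract_leaves fl.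
  - by rewrite !appg; exact: fi.
  - by rewrite contract_leaves => /fs[x xS <-]; exists x; rewrite ?appg.
exists (AHom g2P); split=> [|h hf].
  by apply: A_homP => x xS; rewrite app_contract_comp // appg.
by apply: A_homP => x xS; rewrite -[RHS]app_contract_comp // hf appg.
Qed.

End Contract.

Definition rcontract (T : rtree) (e : nat) (eT : e \in inner T) : rtree :=
  RTree (@contract_reduced T e eT (@rtree_reduced T)).

Section Corolla.
Variable l : nat.
Let E := [fset x in iota 0 l.+1].

Let in_E x : (x \in E) = (x <= l).
Proof. by rewrite in_fset /= -[RHS]ltnS -[x < _]/((0 <= x) && (x < 0 + l.+1)) -mem_iota. Qed.

Lemma corolla_root : l \in E.
Proof. by rewrite in_E. Qed.
Lemma corolla_vert : {subset [fset l] <= E}.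
Proof. by move=> x; rewrite inE => /eqP ->; exact: corolla_root. Qed.
Lemma corolla_below x : x \in E -> x != l -> l \in [fset l].
Proof. by rewrite fset11. Qed.
Lemma corolla_to_root x : x \in E -> exists k, iter k (fun=> l) x = l.
Proof. by move=> _; exists 1. Qed.

(** The corolla with leaves [0, ..., l - 1] and root [l]. *)
Definition corolla : tree :=
  Tree corolla_root corolla_vert corolla_below corolla_to_root.

Lemma corolla_edges x : (x \in edges corolla) = (x <= l).
Proof. exact: in_E. Qed.
Lemma corolla_leaves x : (x \in leaves corolla) = (x < l).
Proof.
by rewrite /leaves in_fsetD corolla_edges /= inE ltn_neqAle.
Qed.
Lemma corolla_inputs v x : (x \in inputs corolla v) = (x < l) && (v == l).
Proof. by rewrite inputsP corolla_edges /= ltn_neqAle andbA (andbC (x <= l)) [l == v]eq_sym. Qed.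

Section Perm.
Variable s : {perm 'I_l}.

Definition corolla_perm_fun (x : nat) : nat :=
  if insub x is Some i then s i : nat else x.

Lemma corolla_perm_edge (x : edges corolla) :
  corolla_perm_fun (val x) \in edges corolla.
Proof.
rewrite corolla_edges /corolla_perm_fun; case: insubP => [i _ _|_].
  exact: ltnW.
by rewrite -corolla_edges; exact: valP.
Qed.

Let f := [ffun x : edges corolla => [` corolla_perm_edge x]].

Lemma app_corolla_perm x : on_edges f x = corolla_perm_fun x.
Proof.
rewrite /on_edges; case: insubP => [y _ <-|]; first by rewrite ffunE.
rewrite corolla_edges /corolla_perm_fun -ltnNge => xl.
by rewrite insubF // ltnNge ltnW.
Qed.

Lemma corolla_perm_root : corolla_perm_fun l = l.
Proof. by rewrite /corolla_perm_fun insubF ?ltnn. Qed.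

Lemma corolla_perm_ord (i : 'I_l) : corolla_perm_fun i = s i.
Proof. by rewrite /corolla_perm_fun valK. Qed.

Lemma corolla_perm_op : `[< preserves_op f >].
Proof.
apply/asboolP; apply: preserves_vertex => v.
rewrite /= inE => /eqP ->; rewrite app_corolla_perm corolla_perm_root.
apply: op_perm (op_vertex _); last by rewrite /= inE.
have fi x : x \in inputs corolla l -> exists2 i : 'I_l, x = i & on_edges f x = s i.
  rewrite corolla_inputs eqxx andbT => xl; exists (Ordinal xl) => //.
  by rewrite app_corolla_perm -corolla_perm_ord.
apply: uniq_perm; rewrite ?fset_uniq //.
  rewrite map_inj_in_uniq ?fset_uniq // => x y /fi[i -> ->] /fi[j -> ->].
  by move=> /val_inj/perm_inj ->.
move=> x; rewrite corolla_inputs eqxx andbT; apply/idP/mapP => [xl|].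
  exists (s^-1%g (Ordinal xl) : nat).
    by rewrite corolla_inputs eqxx andbT.
  by rewrite app_corolla_perm corolla_perm_ord permKV.
by case=> y /fi[i _ ->] ->.
Qed.
Definition corolla_perm : tree_hom corolla corolla := TreeHom corolla_perm_op.

Lemma corolla_perm_A : `[< root_leaves corolla_perm >].
Proof.
have fi x : x \in leaves corolla -> exists2 i : 'I_l, x = i & on_edges f x = s i.
  rewrite corolla_leaves => xl; exists (Ordinal xl) => //.
  by rewrite app_corolla_perm -corolla_perm_ord.
apply/asboolP; split => [|x /fi[i _ ->]|x y /fi[i -> ->] /fi[j -> ->]|x].
- by rewrite app_corolla_perm corolla_perm_root.
- by rewrite corolla_leaves.
- by move=> /val_inj/perm_inj ->.
- rewrite corolla_leaves => xl; exists (s^-1%g (Ordinal xl) : nat).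
    by rewrite corolla_leaves.
  by rewrite app_corolla_perm corolla_perm_ord permKV.
Qed.
Definition corolla_aut : A_hom corolla corolla := AHom corolla_perm_A.
End Perm.

End Corolla.

Local Open Scope ring_scope.

Section HomologyMap.
Variables (A B C A' B' C' : zmodType).
Variables (d1 : {additive A -> B}) (d0 : {additive B -> C}).
Variables (d1' : {additive A' -> B'}) (d0' : {additive B' -> C'}).
Variable f : {additive B -> B'}.
Hypothesis f_ker : forall x, d0 x = 0 -> d0' (f x) = 0.
Hypothesis f_im : forall y, exists y', d1' y' = f (d1 y).

Lemma cycles_map_ker (z : cycles d0) : f (cycle_val z) \in dkernel d0'.
Proof. by rewrite inE; case: z => z /=; rewrite !inE => /eqP/f_ker ->. Qed.
Definition cycles_map (z : cycles d0) : homology_at d1' d0' :=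
  quot_pi _ (Cycle (cycles_map_ker z)).

Lemma cycles_map_zmod : zmod_morphism cycles_map.
Proof.
move=> x y; rewrite /cycles_map -raddfB; congr quot_pi.
by apply: val_inj; rewrite /= raddfB.
Qed.
HB.instance Definition _ := GRing.isZmodMorphism.Build
  (cycles d0) (homology_at d1' d0') cycles_map cycles_map_zmod.

Lemma cycles_map_im (z : cycles d0) :
  (exists y, d1 y = cycle_val z) -> cycles_map z = 0.
Proof.
move=> [y yz]; apply: quot_pi_rel => /=.
by have [y' y'E] := f_im y; exists y'; rewrite y'E yz.
Qed.

Definition homology_map : homology_at d1 d0 -> homology_at d1' d0' :=
  quot_lift cycles_map.
Lemma homology_map_zmod : zmod_morphism homology_map.
Proof. exact: quot_lift_zmod cycles_map_im. Qed.
End HomologyMap.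

Lemma A_app_comp (S T U : tree) (g : A_hom T U) (f : A_hom S T) x :
  x \in edges S -> on_edges (A_comp g f) x = on_edges g (on_edges f x).
Proof. by move=> xS; rewrite /= app_comp. Qed.

Lemma A_section (S T : tree) (f : A_hom S T) (g : A_hom T S) x :
  A_comp g f = A_id S -> x \in edges S -> on_edges g (on_edges f x) = x.
Proof.
move=> /(congr1 (fun h : A_hom S S => on_edges h x)) + xS.
by rewrite /= app_comp // app_id.
Qed.

Lemma A_iso_inj (S T : rtree) (th : @mor AA S T) : is_iso th ->
  {in edges S &, injective (on_edges th)}.
Proof.
move=> [g [gth _]] x y xS yS xy.
have E z : z \in edges S -> on_edges g (on_edges th z) = z.
  exact: A_section gth.
by rewrite -(E x xS) xy E.
Qed.

Lemma contract_iso (S T : rtree) (th : @mor AA S T) e e'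
    (eS : e \in inner S) (eT : e' \in inner T) :
  is_iso th -> on_edges th e = e' ->
  exists th' : @mor AA (rcontract eS) (rcontract eT), is_iso th' /\
    A_comp (contract_A_hom eT) th' = A_comp th (contract_A_hom eS).
Proof.
move=> thi the.
have key (U V : rtree) (f : @mor AA U V) a b (aU : a \in inner U) (bV : b \in inner V) :
    is_iso f -> on_edges f a = b -> exists g : A_hom (contract aU) (contract bV),
      A_comp (contract_A_hom bV) g = A_comp f (contract_A_hom aU).
  move=> fi fa; have [|g [gE _]] := @contract_factor V b bV _ (A_comp f (contract_A_hom aU)).
    move=> x xU; rewrite A_app_comp // app_contract -fa.
    move: xU; rewrite /= !inE => /andP[xa xU'].
    by apply: contra_neq xa => /(A_iso_inj fi) -> //; exact: inner_edge.
  by exists g.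
have [th' th'E] := key _ _ th e e' eS eT thi the.
have [inv [invl invr]] := thi.
have invi : is_iso inv by exists th.
have inve : on_edges inv e' = e.
  by rewrite -the (A_section invl) ?inner_edge.
have [inv' inv'E] := key _ _ inv e' e eT eS invi inve.
exists th'; split=> //; exists inv'; split; apply: contract_mono => /=.
  rewrite A_compA inv'E -A_compA th'E A_compA.
  by rewrite [A_comp inv th]invl A_comp1m A_compm1.
rewrite A_compA th'E -A_compA inv'E A_compA.
by rewrite [A_comp th inv]invr A_comp1m A_compm1.
Qed.

Lemma mark_factor (l : nat) (T : tree) (e : nat) (eT : e \in inner T)
    (a : A_hom (corolla l) T) :
  exists! b : A_hom (corolla l) (contract eT), A_comp (contract_A_hom eT) b = a.
Proof.
apply: contract_factor => x; rewrite corolla_edges leq_eqVlt.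
have /asboolP[ar al _ _] := valP a.
move: eT; rewrite innerP => /andP[er ev] /orP[/eqP ->|xl].
  by rewrite ar eq_sym.
have /al : x \in leaves (corolla l) by rewrite corolla_leaves.
by rewrite inE => /andP[+ _]; apply: contraNneq => ->.
Qed.

(** [contract_mark eT a] is the unique [b] with
[A_comp (contract_A_hom eT) b = a]. *)
Definition contract_mark (l : nat) (T : tree) (e : nat) (eT : e \in inner T)
    (a : A_hom (corolla l) T) : A_hom (corolla l) (contract eT) :=
  sval (cid (mark_factor eT a)).

Lemma contract_markE (l : nat) (T : tree) (e : nat) (eT : e \in inner T)
    (a : A_hom (corolla l) T) :
  A_comp (contract_A_hom eT) (contract_mark eT a) = a.
Proof. by rewrite /contract_mark; case: cid => b []. Qed.

Section Complex.
Variables (M : ab_presheaf AA) (l : nat).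

(** The index set of the direct sum: [cenum] enumerates the inner edges, so that
[ctree] has exactly [n] inner edges. *)
Record cell (n : nat) := Cell {
  ctree : rtree;
  cvert : vert ctree != fset0;
  cmark : A_hom (corolla l) ctree;
  cenum : 'I_n -> nat;
  cenum_inj : injective cenum;
  cenum_inner : forall e, e \in inner ctree <-> exists i, cenum i = e
}.

Definition DC_sum (n : nat) : zmodType :=
  dsum (fun c : {classic cell n} => M (ctree c)).
Definition DC_gen n (c : cell n) (x : M (ctree c)) : DC_sum n :=
  @dsum_inj {classic cell n} (fun c => M (ctree c)) c x.

Section PermCell.
Variables (n : nat) (c : cell n) (t : {perm 'I_n}).
Lemma cell_perm_inj : injective (fun i => cenum c (t i)).
Proof. by move=> i j /cenum_inj/perm_inj. Qed.
Lemma cell_perm_inner e :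
  e \in inner (ctree c) <-> exists i, cenum c (t i) = e.
Proof.
rewrite cenum_inner; split=> -[i ie]; last by exists (t i).
by exists (t^-1%g i); rewrite permKV.
Qed.
Definition cell_perm : cell n :=
  Cell (cvert c) (cmark c) cell_perm_inj cell_perm_inner.
End PermCell.

Inductive DC_rel (n : nat) : DC_sum n -> Prop :=
| DC_iso (c c' : cell n) (th : @mor AA (ctree c) (ctree c')) (x : M (ctree c')) of
    is_iso th & cmark c' = A_comp th (cmark c) &
    (forall i, cenum c' i = on_edges th (cenum c i)) :
    DC_rel (DC_gen (ap_map M th x) - DC_gen x)
| DC_sgn (c : cell n) (t : {perm 'I_n}) (x : M (ctree c)) :
    DC_rel (DC_gen x - DC_gen (c := cell_perm c t) x *~ (-1) ^+ t).

(** The chain group in degree [p = n - 1]. *)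
Definition DC (n : nat) : zmodType := gquot (@DC_rel n).

Definition DC_class n (c : cell n) (x : M (ctree c)) : DC n :=
  quot_pi (@DC_rel n) (DC_gen x).

Section Face.
Variables (n : nat) (c : cell n) (i : 'I_n).
Lemma cenum_in : cenum c i \in inner (ctree c).
Proof. by apply/cenum_inner; exists i. Qed.
Lemma face_vert : vert (rcontract cenum_in) != fset0.
Proof.
apply/fset0Pn; exists (below (ctree c) (cenum c i)); have := cenum_in.
rewrite innerP => /andP[er /vert_edge ee].
by rewrite /= !inE below_neq // below_vert.
Qed.
Lemma face_enum_inj : injective (fun k => cenum c (lift i k)).
Proof. by move=> j k /cenum_inj/lift_inj. Qed.
Lemma face_enum_inner e : e \in inner (rcontract cenum_in) <->
  exists k, cenum c (lift i k) = e.
Proof.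
rewrite innerP /= !inE andbCA -innerP; split.
  move=> /andP[ei /cenum_inner[j je]].
  have [k jk|ij] := unliftP i j; first by exists k; rewrite -jk.
  by rewrite -je ij eqxx in ei.
move=> [k <-]; apply/andP; split; last by apply/cenum_inner; exists (lift i k).
by apply/eqP => /cenum_inj/eqP; rewrite eq_sym (negPf (neq_lift _ _)).
Qed.
Definition face : cell n.-1 :=
  @Cell n.-1 (rcontract cenum_in) face_vert (contract_mark cenum_in (cmark c))
    (fun k => cenum c (lift i k)) face_enum_inj face_enum_inner.
Definition face_hom : @mor AA (ctree face) (ctree c) := contract_A_hom cenum_in.
End Face.

Definition DC_bound_cell n (c : cell n) (x : M (ctree c)) : DC n.-1 :=
  \sum_(i < n) DC_class (ap_map M (face_hom c i) x) *~ (-1) ^+ i.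

Definition DC_bound_sum n : DC_sum n -> DC n.-1 :=
  dsum_lift (fun c : {classic cell n} => @DC_bound_cell n c).

Lemma DC_class_zmod n (c : cell n) : zmod_morphism (@DC_class n c).
Proof. by move=> x y; rewrite /DC_class /DC_gen !raddfB. Qed.

Lemma DC_bound_cell_zmod n (c : cell n) : zmod_morphism (@DC_bound_cell n c).
Proof.
move=> x y; rewrite /DC_bound_cell -sumrB; apply: eq_bigr => i _.
by rewrite raddfB DC_class_zmod mulrzBl.
Qed.
Lemma DC_bound_sum_zmod n : zmod_morphism (@DC_bound_sum n).
Proof. by apply: dsum_lift_zmod => c; exact: DC_bound_cell_zmod. Qed.
HB.instance Definition _ n := GRing.isZmodMorphism.Build (DC_sum n) (DC n.-1)
  (@DC_bound_sum n) (@DC_bound_sum_zmod n).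

Lemma DC_bound_gen n (c : cell n) (x : M (ctree c)) :
  DC_bound_sum (DC_gen x) = DC_bound_cell x.
Proof. by apply: dsum_lift_inj => c'; exact: DC_bound_cell_zmod. Qed.

Lemma DC_class_iso n (c c' : cell n) (th : @mor AA (ctree c) (ctree c'))
    (x : M (ctree c')) :
  is_iso th -> cmark c' = A_comp th (cmark c) ->
  (forall i, cenum c' i = on_edges th (cenum c i)) ->
  DC_class (ap_map M th x) = DC_class x.
Proof.
move=> thi thm the; apply/eqP; rewrite -subr_eq0 -raddfB; apply/eqP/quot_pi_rel.
exact: DC_iso.
Qed.

Lemma DC_class_sgn n (c : cell n) (t : {perm 'I_n}) (x : M (ctree c)) :
  DC_class (c := cell_perm c t) x = DC_class x *~ (-1) ^+ t.
Proof.
have /quot_pi_rel/eqP := DC_sgn t x.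
rewrite raddfB raddfMz subr_eq0 => /eqP E.
have -> : DC_class x = DC_class (c := cell_perm c t) x *~ (-1) ^+ t by [].
by rewrite -mulrzA -signr_addb addbb.
Qed.

Lemma DC_class_face n (c c' : cell n) (i j : 'I_n) (s : {perm 'I_n.-1})
    (th : @mor AA (ctree c) (ctree c')) (x : M (ctree c')) :
  is_iso th -> cmark c' = A_comp th (cmark c) ->
  cenum c' j = on_edges th (cenum c i) ->
  (forall k, cenum c' (lift j (s k)) = on_edges th (cenum c (lift i k))) ->
  DC_class (ap_map M (face_hom c i) (ap_map M th x)) =
  DC_class (ap_map M (face_hom c' j) x) *~ (-1) ^+ s.
Proof.
move=> thi thm thj thk.
have [th' [th'i th'E]] :=
  contract_iso (cenum_in c i) (cenum_in c' j) thi (esym thj).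
have -> : ap_map M (face_hom c i) (ap_map M th x) =
    ap_map M th' (ap_map M (face_hom c' j) x).
  have e : mcomp th (face_hom c i) = mcomp (face_hom c' j) th' := esym th'E.
  by rewrite -!ap_mapM e.
rewrite -DC_class_sgn.
apply: (@DC_class_iso _ (face c i) (cell_perm (face c' j) s)) => //=.
  apply: contract_mono; rewrite A_compA contract_markE.
  by rewrite [A_comp _ th']th'E -A_compA contract_markE.
move=> k; rewrite thk.
have kE : cenum c (lift i k) \in edges (contract (cenum_in c i)).
  have /inner_edge := cenum_in (face c i) k; exact.
rewrite -(@app_contract_comp _ _ (cenum_in c' j) _ th') //.
by rewrite th'E A_app_comp // app_contract.
Qed.

Lemma perm_face n (t : {perm 'I_n}) (i : 'I_n) :
  exists2 s : {perm 'I_n.-1}, forall k, t (lift i k) = lift (t i) (s k) &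
    odd_perm s = odd_perm t (+) odd i (+) odd (t i).
Proof.
case: n t i => [|n] t i; first by case: i.
have tk k : t (lift i k) != t i.
  by rewrite (inj_eq perm_inj) eq_sym neq_lift.
pose f k := odflt k (unlift (t i) (t (lift i k))).
have fE k : lift (t i) (f k) = t (lift i k).
  rewrite /f; case: unliftP => [j -> //|/eqP]; by rewrite (negPf (tk k)).
have fI : injective f.
  by move=> a b ab; apply/(@lift_inj _ i)/(@perm_inj _ t); rewrite -!fE ab.
exists (perm fI) => [k|]; first by rewrite permE fE.
have tE : t = lift_perm i (t i) (perm fI).
  apply/permP => j; have [k ->|->] := unliftP i j.
    by rewrite lift_perm_lift permE fE.
  by rewrite lift_perm_id.
have := congr1 (@odd_perm _) tE; rewrite odd_lift_perm => ->.
by case: (odd i); case: (odd (t i)); case: (odd_perm (perm fI)).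
Qed.

Lemma DC_bound_rel n (r : DC_sum n) : DC_rel r -> DC_bound_sum r = 0.
Proof.
case=> [c c' th x thi thm the|c t x]; rewrite raddfB ?raddfMz /= !DC_bound_gen.
  rewrite -sumrB big1 // => i _; rewrite -mulrzBl.
  rewrite (DC_class_face (s := 1%g) (j := i) x thi thm) ?odd_perm1 ?mulr1z //.
    by rewrite subrr mul0rz.
  by move=> k; rewrite perm1.
apply/eqP; rewrite mulNrz subr_eq0; apply/eqP.
rewrite /DC_bound_cell (reindex_inj (@perm_inj _ t)) mulrz_suml.
apply: eq_bigr => i _; have [s sE so] := perm_face t i.
have id_iso : is_iso (idmor (ctree c : AA)).
  by exists (idmor _); rewrite /= A_comp1m.
have := @DC_class_face n (cell_perm c t) c i (t i) s (idmor _) x id_iso.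
rewrite ap_map1 /= => -> //.
- rewrite -!mulrzA so; congr (_ *~ _).
  rewrite -(signr_odd _ i) -(signr_odd _ (t i)).
  by case: (odd_perm t); case: (odd i); case: (odd (t i)).
- by rewrite A_comp1m.
- by rewrite app_id.
- by move=> k; rewrite app_id sE.
Qed.

(** The differential from degree [n - 1] to degree [n - 2]; it is zero for
[n = 0]. *)
Definition DC_d n : DC n -> DC n.-1 := quot_lift (@DC_bound_sum n).
Lemma DC_d_zmod n : zmod_morphism (@DC_d n).
Proof. exact: quot_lift_zmod (@DC_bound_rel n). Qed.
HB.instance Definition _ n :=
  GRing.isZmodMorphism.Build (DC n) (DC n.-1) (@DC_d n) (@DC_d_zmod n).

Lemma DC_d_class n (c : cell n) (x : M (ctree c)) :
  DC_d (DC_class x) = DC_bound_cell x.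
Proof. by rewrite /DC_d (quot_lift_pi (@DC_bound_rel n)) /= DC_bound_gen. Qed.

(** Dendroidal homology in degree [p = n - 1]. *)
Definition DH (n : nat) : zmodType := homology_at (@DC_d n.+1) (@DC_d n).

Section Action.
Variable s : {perm 'I_l}.

Definition cell_act n (c : cell n) : cell n :=
  @Cell n (ctree c) (cvert c) (A_comp (cmark c) (corolla_aut s))
    (cenum c) (@cenum_inj _ c) (@cenum_inner _ c).

Definition DC_act_sum n : DC_sum n -> DC n :=
  dsum_lift (fun (c : {classic cell n}) x => @DC_class n (cell_act c) x).
Lemma DC_act_sum_zmod n : zmod_morphism (@DC_act_sum n).
Proof. by apply: dsum_lift_zmod => c; exact: (@DC_class_zmod n (cell_act c)). Qed.
HB.instance Definition _ n := GRing.isZmodMorphism.Build (DC_sum n) (DC n)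
  (@DC_act_sum n) (@DC_act_sum_zmod n).

Lemma DC_act_gen n (c : cell n) (x : M (ctree c)) :
  DC_act_sum (DC_gen x) = DC_class (c := cell_act c) x.
Proof. by apply: dsum_lift_inj => c'; exact: (@DC_class_zmod n (cell_act c')). Qed.

Lemma DC_act_rel n (r : DC_sum n) : DC_rel r -> DC_act_sum r = 0.
Proof.
case=> [c c' th x thi thm the|c t x]; rewrite raddfB ?raddfMz /= !DC_act_gen.
  rewrite (@DC_class_iso _ (cell_act c) (cell_act c') th) ?subrr //.
  by rewrite /= thm A_compA.
apply/eqP; rewrite mulNrz subr_eq0; apply/eqP.
have E := @DC_class_iso _ (cell_act (cell_perm c t))
  (cell_perm (cell_act c) t) (idmor (ctree c : AA)) x.
rewrite ap_map1 in E; rewrite E.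
- by rewrite DC_class_sgn -mulrzA -signr_addb addbb.
- by exists (idmor _); rewrite /= A_comp1m.
- by rewrite /= A_comp1m.
- by move=> i; rewrite /= app_id.
Qed.

Definition DC_act n : DC n -> DC n := quot_lift (@DC_act_sum n).
Lemma DC_act_zmod n : zmod_morphism (@DC_act n).
Proof. exact: quot_lift_zmod (@DC_act_rel n). Qed.
HB.instance Definition _ n :=
  GRing.isZmodMorphism.Build (DC n) (DC n) (@DC_act n) (@DC_act_zmod n).

Lemma DC_act_class n (c : cell n) (x : M (ctree c)) :
  DC_act (DC_class x) = DC_class (c := cell_act c) x.
Proof. by rewrite /DC_act (quot_lift_pi (@DC_act_rel n)) /= DC_act_gen. Qed.

Lemma DC_ind n (P : DC n -> Prop) : P 0 ->
  (forall u v, P u -> P v -> P (u + v)) ->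
  (forall (c : cell n) (x : M (ctree c)), P (DC_class x)) -> forall u, P u.
Proof.
move=> P0 PD Pc u; have [y ->] := quot_piP u.
elim/dsum_ind: y => [|f g Pf Pg|c x]; first by rewrite raddf0.
  by rewrite raddfD; exact: PD.
exact: Pc.
Qed.

Lemma DC_act_d n (u : DC n) : DC_d (DC_act u) = DC_act (DC_d u).
Proof.
elim/DC_ind: u => [|u v IHu IHv|c x]; first by rewrite !raddf0.
  by rewrite !raddfD /= IHu IHv.
rewrite DC_act_class !DC_d_class raddf_sum; apply: eq_bigr => i _.
rewrite raddfMz /= DC_act_class; congr (_ *~ _).
have id_iso : is_iso (idmor (ctree c : AA)).
  by exists (idmor _); rewrite /= A_comp1m.
have [th [thi thE]] := contract_iso (cenum_in c i)
  (cenum_in (cell_act c) i) id_iso (app_id _ _).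
have -> : ap_map M (face_hom c i) x =
    ap_map M th (ap_map M (face_hom (cell_act c) i) x).
  have e : mcomp (face_hom (cell_act c) i) th = face_hom c i.
    by rewrite /= /face_hom thE A_comp1m.
  by rewrite -ap_mapM e.
symmetry; apply: (@DC_class_iso _ (cell_act (face c i)) (face (cell_act c) i) th).
- exact: thi.
- apply: contract_mono; rewrite /= contract_markE !A_compA.
  by rewrite [A_comp _ th]thE A_comp1m contract_markE.
- move=> k; have kE := inner_edge (cenum_in (face c i) k).
  rewrite -(@app_contract_comp _ _ (cenum_in (cell_act c) i) _ th) //.
  by rewrite thE A_comp1m app_contract.
Qed.

Lemma DC_act_ker n (u : DC n) : DC_d u = 0 -> DC_d (DC_act u) = 0.
Proof. by rewrite DC_act_d => ->; exact: raddf0. Qed.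

Definition DH_act n : DH n -> DH n :=
  @homology_map _ _ _ _ _ _ (@DC_d n.+1) (@DC_d n) (@DC_d n.+1) (@DC_d n)
    (@DC_act n) (@DC_act_ker n).
Lemma DH_act_zmod n : zmod_morphism (@DH_act n).
Proof.
by apply: homology_map_zmod => y; exists (DC_act y); exact: (@DC_act_d n.+1).
Qed.
End Action.
End Complex.

Record numbering (l : nat) (X : finType) := Numbering {
  nb_fun :> 'I_l -> X;
  nb_inv : X -> 'I_l;
  nb_funK : cancel nb_fun nb_inv;
  nb_invK : cancel nb_inv nb_fun
}.

Section RegularAction.
Variables (l : nat) (X : finType) (b : numbering l X) (s : {perm 'I_l}).

Lemma relabel_inj : injective (fun x => b (s (nb_inv b x))).
Proof.
move=> x y /(can_inj (@nb_funK _ _ b))/perm_inj; exact: (can_inj (@nb_invK _ _ b)).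
Qed.
Definition relabel : {perm X} := perm relabel_inj.

(** [t] goes to [t \o relabel], extended linearly. *)
Definition regular_act : freeab {perm X} -> freeab {perm X} :=
  dsum_lift (fun (t : {perm X}) k => freeab_gen (relabel * t)%g *~ k).
End RegularAction.

Definition Vert (T : tree) (l : nat) : finType :=
  {v : vert T | #|` inputs T (val v)| == l}.
Definition Vert_inputs (T : tree) (l : nat) (v : Vert T l) : finType :=
  inputs T (val (val v)).

(** The direct sum of the [Z[Sigma_(inputs v)]] in the component [l], and the
action of [Sigma_l] on it for given numberings of the inputs. *)
Definition vertex_sum (T : tree) (l : nat) : zmodType :=
  dsum (fun v : Vert T l => freeab {perm Vert_inputs v}).
Definition vertex_sum_act (T : tree) (l : nat)
    (b : forall v : Vert T l, numbering l (Vert_inputs v)) (s : {perm 'I_l}) :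
    vertex_sum T l -> vertex_sum T l :=
  dsum_lift (fun v x => @dsum_inj _ (fun v => freeab {perm Vert_inputs v}) v
    (regular_act (b v) s x)).

(* Main.v *)
(** Every vertex has at least two inputs, so distinct edges of [T] have distinct
sets of leaves above them, these sets form a laminar family, and a list of edges
is the source of an operation of [T] exactly when their leaf sets partition that
of the target. Hence a morphism of reduced trees is injective on edges and
reflects operations, so that a marked tree over [T] is determined, up to
isomorphism, by the operation [g] of [T] that its marking composes to and by the
images in [T] of its inner edges; these may form any subset of the inner edges
of the subtree of [T] spanned by [g]. The complex splits over [g] into augmented
chain complexes of simplices. These are contractible, by coning from a vertex,
unless the spanned subtree has no inner edge: then it is the corolla of a vertex
of [T] with a numbering of its inputs, and contributes a copy of the integers in
degree -1. *)
Require Import Defs.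
From HB Require Import structures.
From mathcomp Require Import all_boot all_fingroup all_algebra finmap.
From mathcomp Require Import boolp zify.

Set Implicit Arguments.
Unset Strict Implicit.
Unset Printing Implicit Defensive.

Import GRing.Theory.
Local Open Scope fset_scope.
Local Open Scope nat_scope.

(** * Trees as laminar families of leaf sets *)

Section TreeOrder.
Variable T : tree.

(** [below] is unconstrained at the root, so it cannot be iterated past it. *)
Definition up (x : nat) : nat := if x == troot T then x else below T x.
Definition anc (x y : nat) : bool := `[< exists k, iter k up y = x >].
Definition leaves_above (x : nat) : {fset nat} :=
  [fset z in leaves T | anc x z].

Lemma ancP x y : reflect (exists k, iter k up y = x) (anc x y).
Proof. exact: asboolP. Qed.

Lemma anc_refl x : anc x x.
Proof. by apply/ancP; exists 0. Qed.

Lemma anc_trans y x z : anc x y -> anc y z -> anc x z.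
Proof.
move=> /ancP[k <-] /ancP[j <-]; apply/ancP; exists (k + j).
by rewrite iterD.
Qed.

(** Both edges lie on the one path from [z] to the root; the one reached in fewer steps is above. *)
Lemma anc_total x y z : anc x z -> anc y z -> anc x y || anc y x.
Proof.
move=> /ancP[k kx] /ancP[j jy].
have [kj|jk] := leqP k j; apply/orP; [right|left]; apply/ancP.
  by exists (j - k); rewrite -kx -jy -iterD subnK.
by exists (k - j); rewrite -kx -jy -iterD subnK // ltnW.
Qed.

Lemma up_root : up (troot T) = troot T.
Proof. by rewrite /up eqxx. Qed.

Lemma up_edge x : x \in edges T -> up x \in edges T.
Proof.
by rewrite /up; case: eqVneq => // xr xT; rewrite vert_edge ?below_vert.
Qed.

Lemma anc_iter_below x y : anc x y -> exists k, iter k (below T) y = x.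
Proof.
move=> /ancP[k <-]; elim: k y => [|k IH] y; first by exists 0.
rewrite iterSr {2}/up; case: eqVneq => // _; have [j <-] := IH (below T y).
by exists j.+1; rewrite iterSr.
Qed.

Lemma root_anc x : x \in edges T -> anc (troot T) x.
Proof.
move=> /to_root[k]; elim: k x => [|k IH] x.
  by move=> /= ->; exact: anc_refl.
have [-> _|xr] := eqVneq x (troot T); first exact: anc_refl.
rewrite iterSr => /IH; move/anc_trans; apply.
by apply/ancP; exists 1; rewrite /= /up (negPf xr).
Qed.

Lemma anc_up x : anc (up x) x.
Proof. by apply/ancP; exists 1. Qed.

Lemma anc_strict x y : anc x y -> x != y -> anc x (up y).
Proof.
move=> /ancP[[|k]] /=; first by move=> ->; rewrite eqxx.
by move=> <- _; apply/ancP; exists k; rewrite -iterSr.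
Qed.

Lemma iter_up_root k : iter k up (troot T) = troot T.
Proof. by elim: k => //= k ->; rewrite up_root. Qed.

Lemma anc_antisym x y : y \in edges T -> anc x y -> anc y x -> x = y.
Proof.
move=> yT /ancP[k kx] /ancP[j jy].
have [m mr] := ancP _ _ (root_anc yT).
have loop i : iter (i * (j + k)) up y = y.
  by elim: i => // i IH; rewrite mulSn iterD IH iterD kx.
have [/eqP jk|jk] := posnP (j + k).
  by move: jk; rewrite addn_eq0 => /andP[_ /eqP k0]; rewrite -kx k0.
(* Going [m] times round a loop of positive length takes at least the [m] steps that lead to the
   root, where [up] stays. *)
have yr : y = troot T.
  rewrite -(loop m) -(subnK (leq_pmulr m jk)) iterD mr.
  exact: iter_up_root.
by rewrite -kx yr iter_up_root.
Qed.

Lemma input_up v y : y \in inputs T v -> [/\ y \in edges T, up y = v & y != v].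
Proof.
rewrite inputsP => /and3P[yT yr /eqP yv].
by rewrite /up (negPf yr) yv; split=> //; rewrite -yv eq_sym below_neq.
Qed.

Lemma input_anc v y : y \in inputs T v -> anc v y.
Proof. by move=> /input_up[_ <- _]; exact: anc_up. Qed.

Lemma anc_input v y : y \in edges T -> anc v y -> v != y ->
  exists2 w, w \in inputs T v & anc w y.
Proof.
move=> yT /ancP[k]; elim: k y yT => [|k IH] y yT; first by move=> /= ->; rewrite eqxx.
rewrite iterSr; have [uv _ vy|uv /IH H _] := eqVneq v (up y).
  exists y; last exact: anc_refl.
  have yr : y != troot T.
    by apply: contra_neq vy => yr; rewrite uv yr up_root.
  by rewrite inputsP yT yr uv /up (negPf yr) eqxx.
have [||w wv wy] := H; rewrite ?up_edge //.
by exists w => //; apply: anc_trans wy (anc_up _).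
Qed.

(** Ancestors of [y] are comparable, and of two distinct comparable inputs of [v] the lower one
    would be an ancestor of [v] itself. *)
Lemma input_eq v w w' y :
  w \in inputs T v -> w' \in inputs T v -> anc w y -> anc w' y -> w = w'.
Proof.
move=> wv w'v wy w'y.
suff H a a' : a \in inputs T v -> a' \in inputs T v -> anc a a' -> a = a'.
  have /orP[/(H _ _ wv w'v)//|/(H _ _ w'v wv) ->//] := anc_total wy w'y.
move=> /input_up[aT au av] /input_up[a'T a'u _] aa'.
have [//|ne] := eqVneq a a'.
have := anc_strict aa' ne; rewrite a'u => av'.
have vT : v \in edges T by rewrite -au up_edge.
have va : anc v a by rewrite -au anc_up.
by move: av; rewrite (anc_antisym vT av' va) eqxx.
Qed.

Lemma inputs_vert v y : y \in inputs T v -> v \in vert T.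
Proof. by rewrite inputsP => /and3P[yT yr /eqP <-]; exact: below_vert. Qed.

(** Induction from the leaves towards the root, on the number of edges above [x]. *)
Lemma edge_ind (P : nat -> Prop) :
  (forall x, x \in edges T -> (forall y, y \in inputs T x -> P y) -> P x) ->
  forall x, x \in edges T -> P x.
Proof.
move=> H x; pose A x := [fset y in edges T | anc x y].
have [n] := ubnP #|` A x|; elim: n x => // n IH x le_n xT.
apply: H => // y yx; have [yT _ ne] := input_up yx; apply: IH => //.
have xy := input_anc yx.
apply: leq_trans (le_n : #|` A x| <= n); apply: fproper_ltn_card.
rewrite fproperE; apply/andP; split.
  by apply/fsubsetP => z; rewrite !inE => /andP[-> yz]; exact: anc_trans yz.
apply/fsubsetPn; exists x; rewrite ?inE ?xT ?anc_refl //=.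
by apply: contraNN ne => yx'; rewrite (anc_antisym xT yx' xy).
Qed.

Lemma leaves_aboveP x z : (z \in leaves_above x) = (z \in leaves T) && anc x z.
Proof. by rewrite !inE. Qed.

Lemma leaves_above_leaf x : x \in leaves T -> leaves_above x = [fset x].
Proof.
move=> xl; apply/fsetP => z; rewrite leaves_aboveP inE.
apply/andP/eqP => [[zl xz]|->]; last by rewrite anc_refl.
apply/esym/eqP; apply: contraTT xl => ne.
have [w /inputs_vert xv _] := anc_input (leaf_edge zl) xz ne.
by rewrite inE xv.
Qed.

Lemma leaves_above_sub x y : anc x y -> leaves_above y `<=` leaves_above x.
Proof.
move=> xy; apply/fsubsetP => z; rewrite !leaves_aboveP => /andP[-> yz].
exact: anc_trans yz.
Qed.

Lemma leaves_above_root : leaves_above (troot T) = leaves T.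
Proof.
apply/fsetP => z; rewrite leaves_aboveP andb_idr // => /leaf_edge.
exact: root_anc.
Qed.

(** Counting states disjointness and covering of the leaf sets in one equation, and it is additive
    under concatenation of lists. *)
Lemma count_inputs v z : v \in vert T ->
  count (fun x => z \in leaves_above x) (inputs T v) = (z \in leaves_above v).
Proof.
move=> vT.
have [zv|zv] := boolP (z \in leaves_above v); last first.
  apply/eqP; rewrite -leqn0 -ltnS ltnNge -has_count; apply/hasPn => x xv.
  by apply: contra zv; apply: (fsubsetP (leaves_above_sub (input_anc xv))).
move: zv; rewrite leaves_aboveP => /andP[zl vz].
have [|w wv wz] := anc_input (leaf_edge zl) vz.
  by apply: contraTneq vT => ->; move: zl; rewrite inE => /andP[].
rewrite (@eq_in_count _ _ (pred1 w)) ?count_uniq_mem ?fset_uniq ?wv //.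
move=> x xv /=; rewrite leaves_aboveP zl /=.
by apply/idP/eqP => [xz|->//]; exact: (input_eq xv wv xz wz).
Qed.

End TreeOrder.

(** * Operations as partitions of leaf sets *)

Section ReducedTree.
Variable T : rtree.
Local Notation L := (@leaves_above T).

Lemma vert_inputs v : v \in vert T ->
  exists w w', [/\ w \in inputs T v, w' \in inputs T v & w != w'].
Proof.
move=> /(@rtree_reduced T); move: (fset_uniq (inputs T v)).
rewrite cardfE -cardfE; case E: (inputs T v : seq nat) => [|w [|w' s]] //= /andP[+ _] _.
rewrite inE negb_or => /andP[ne _]; exists w, w'.
have mem x : x \in inputs T v = (x \in (inputs T v : seq nat)) by [].
by rewrite !mem !E !inE !eqxx orbT.
Qed.

Lemma leaves_above_nonempty x : x \in edges T -> exists z, z \in L x.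
Proof.
move: x; apply: edge_ind => x xT IH.
have [xv|xv] := boolP (x \in vert T); last first.
  by exists x; rewrite leaves_aboveP anc_refl inE xv xT.
have [w [_ [wx _ _]]] := vert_inputs xv; have [z zw] := IH _ wx.
by exists z; apply: (fsubsetP (leaves_above_sub (input_anc wx))).
Qed.

(** A leaf above [y] makes the edges comparable. If [y] were strictly below [x], an input of [y] not
    leading to [x] would carry a leaf that is not above [x]. *)
Lemma leaves_above_anc x y : x \in edges T -> y \in edges T ->
  L y `<=` L x -> anc T x y.
Proof.
move=> xT yT yx; have [z zy] := leaves_above_nonempty yT.
have zx := fsubsetP yx _ zy.
move: (zx) (zy); rewrite !leaves_aboveP => /andP[zl xz] /andP[_ yz].
have /orP[//|yax] := anc_total xz yz.
have [->|ne] := eqVneq x y; first exact: anc_refl.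
have [w wy wx] : exists2 w, w \in inputs T y & anc T w x.
  by apply: anc_input => //; rewrite eq_sym.
have [w1 [w2 [w1y w2y ne12]]] := vert_inputs (inputs_vert wy).
have [w' [w'y nw]] : exists w', w' \in inputs T y /\ w' != w.
  by have [E|] := eqVneq w1 w; [exists w2; rewrite -E eq_sym|exists w1].
have [w'T _ _] := input_up w'y.
have [z' z'w'] := leaves_above_nonempty w'T.
have z'x : z' \in L x.
  apply: (fsubsetP yx).
  exact: (fsubsetP (leaves_above_sub (input_anc w'y))).
move: z'w' z'x; rewrite !leaves_aboveP => /andP[_ w'z'] /andP[_ xz'].
by move: nw; rewrite (input_eq w'y wy w'z' (anc_trans wx xz')) eqxx.
Qed.

Lemma leaves_above_inj : {in edges T &, injective L}.
Proof.
move=> x y xT yT xy; apply: (anc_antisym yT).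
  by apply: leaves_above_anc => //; rewrite xy.
by apply: leaves_above_anc => //; rewrite xy.
Qed.

(** Replacing a block of a partition by a partition of that block gives a partition again. *)
Lemma op_count s e : tree_op T s e ->
  forall z, count (fun x => z \in L x) s = (z \in L e).
Proof.
elim=> {s e} [e eT|v vT|s t e st _ IH|s1 x s2 t e _ IH1 _ IH2] z.
- by rewrite /= addn0.
- exact: count_inputs.
- by rewrite -IH (seq.permP st).
- by rewrite -IH1 !count_cat IH2 /=.
Qed.

Lemma op_comp_seq (s : seq nat) (F : nat -> seq nat) e :
  (forall y, y \in s -> tree_op T (F y) y) -> tree_op T s e ->
  tree_op T (flatten (map F s)) e.
Proof.
suff H a t : (forall y, y \in t -> tree_op T (F y) y) -> tree_op T (a ++ t) e ->
    tree_op T (a ++ flatten (map F t)) e by move=> Fs; exact: (H [::]).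
elim: t a => //= y t IH a Ft o.
rewrite catA; apply: IH => [z zt|]; first by apply: Ft; rewrite inE zt orbT.
by rewrite -catA; apply: op_comp o (Ft _ (mem_head _ _)).
Qed.

(** Unless [s] is just [e], its members distribute over the inputs of [e]. Those above one input
    partition its leaf set, so they form an operation by induction; composing with the vertex [e]
    gives [s] up to order. *)
Lemma count_op e : e \in edges T -> forall s, {subset s <= edges T} ->
  (forall z, count (fun x => z \in L x) s = (z \in L e)) -> tree_op T s e.
Proof.
move: e; apply: edge_ind => e eT IH s sT cs.
have below_e x : x \in s -> L x `<=` L e.
  move=> xs; apply/fsubsetP => z zx; have := cs z.
  case: (z \in L e) => // /eqP; rewrite -leqn0 leqNgt -has_count.
  by move=> /hasPn/(_ x xs)/negP.
(* If [e] occurs, it exhausts its leaf set, and a leaf of any further member would be counted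
   twice. *)
have [es|es] := boolP (e \in s).
  have [[|y t] pt] : exists t, perm_eq s (e :: t).
  - by exists (rem e s); exact: perm_to_rem.
  - by apply: op_perm (op_unit eT); rewrite perm_sym.
  have ys : y \in s by rewrite (perm_mem pt) !inE eqxx orbT.
  have [z zy] := leaves_above_nonempty (sT _ ys).
  have := cs z; rewrite (seq.permP pt) /= zy (fsubsetP (below_e _ ys) _ zy) addnA.
  by move=> /eqP; rewrite !addSn.
have anc_e x : x \in s -> exists2 w, w \in inputs T e & anc T w x.
  move=> xs; apply: anc_input (sT _ xs) _ _; last by apply: contraNneq es => ->.
  by apply: leaves_above_anc => //; [exact: sT|exact: below_e].
have [z ze] := leaves_above_nonempty eT.
have /hasP[x0 x0s _] : has (fun x => z \in L x) s by rewrite has_count cs ze.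
have [w0 /inputs_vert ev _] := anc_e _ x0s.
pose F y := [seq x <- s | anc T y x].
have oF : tree_op T (flatten (map F (inputs T e))) e.
  apply: op_comp_seq (op_vertex ev) => y ye; apply: IH => // [x|z'].
    by rewrite mem_filter => /andP[_]; exact: sT.
  rewrite count_filter.
  have [zy|zy] := boolP (z' \in L y).
    have ze' : z' \in L e by exact: (fsubsetP (leaves_above_sub (input_anc ye))).
    rewrite -[RHS]/(true : nat) -ze' -cs; apply: eq_in_count => x xs /=.
    apply: andb_idr => zx; have [w we wx] := anc_e _ xs.
    move: zx zy; rewrite !leaves_aboveP => /andP[_ xz] /andP[_ yz].
    by rewrite -(input_eq we ye (anc_trans wx xz) yz).
  apply/eqP; rewrite -leqn0 leqNgt -has_count; apply/hasPn => x xs /=.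
  by apply: contra zy => /andP[zx yx]; exact: (fsubsetP (leaves_above_sub yx)).
(* Each member of [s] lies above exactly one input of [e]; exchanging the sums counts member by
   member. *)
apply: op_perm oF; apply/seq.permP => a.
rewrite count_flatten -map_comp sumnE big_map.
under eq_bigr do rewrite /= count_filter -sum1_count big_mkcond.
rewrite exchange_big /= -sum1_count [RHS]big_mkcond /= [LHS]big_seq [RHS]big_seq.
apply: eq_bigr => x xs; have [w we wx] := anc_e _ xs.
rewrite (big_rem w) //= wx andbT big_seq big1 ?addn0 // => y.
rewrite mem_rem_uniq ?fset_uniq // => /andP[yw ye].
case: ifP => // /andP[_ yx]; move: yw.
by rewrite (input_eq ye we yx wx) /in_mem /= eqxx.
Qed.

Lemma op_leaves_above e : e \in edges T -> tree_op T (L e) e.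
Proof.
move=> eT; apply: count_op => // [x|z].
  by rewrite leaves_aboveP => /andP[/leaf_edge].
rewrite (@eq_in_count _ _ (pred1 z)) ?count_uniq_mem ?fset_uniq // => x.
move=> xe; have /andP[xl _] : (x \in leaves T) && anc T e x by rewrite -leaves_aboveP.
by rewrite leaves_above_leaf // inE eq_sym.
Qed.

End ReducedTree.

(** * Morphisms of reduced trees *)

Section ReducedHom.
Variables S T : rtree.
Implicit Type f : tree_hom S T.
Local Notation L := (@leaves_above T).

(** The leaf [z] of [T] detects the leaf [x] of [S]: the image of the operation from all leaves of
    [S] to its root puts [z] above no other leaf image. The image of the operation from the leaves
    above [e] then gives the claim. *)
Lemma hom_leaves_above f e x z : e \in edges S -> x \in leaves S ->
  z \in L (on_edges f x) ->
  (z \in L (on_edges f e)) = (x \in leaves_above S e).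
Proof.
move=> eS xl zx.
have cnt u : u \in edges S ->
    count (fun y => z \in L (on_edges f y)) (leaves_above S u) =
    (z \in L (on_edges f u)).
  move=> uS; have := op_count (tree_hom_op f (op_leaves_above uS)) z.
  by rewrite count_map.
have xS := leaf_edge xl.
have uniq_leaf y : y \in leaves S -> z \in L (on_edges f y) -> y = x.
  move=> yl zy; apply/eqP; apply: contraT => yx.
  have := cnt _ (root_edge S); rewrite leaves_above_root.
  rewrite (seq.permP (perm_to_rem yl)) /= zy => cE.
  have: 0 < count (fun y => z \in L (on_edges f y)) (rem y (leaves S)).
    rewrite -has_count; apply/hasP; exists x => //.
    by rewrite mem_rem_uniq ?fset_uniq // inE eq_sym yx.
  by case: (z \in _) cE => /=; lia.
apply/idP/idP => [ze|xe].
  have /hasP[y ye zy] : has (fun y => z \in L (on_edges f y)) (leaves_above S e).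
    by rewrite has_count cnt // ze.
  have yl : y \in leaves S by have := ye; rewrite leaves_aboveP => /andP[].
  by rewrite -(uniq_leaf _ yl zy).
rewrite -[_ \in _]lt0b -cnt // -has_count; apply/hasP; by exists x.
Qed.

Lemma hom_leaf_pick f x : x \in edges S -> exists z, z \in L (on_edges f x).
Proof. by move=> xS; apply: leaves_above_nonempty; exact: app_edge. Qed.

(** By [hom_leaves_above] the image of an edge determines its leaf set, and leaf sets separate
    edges. *)
Lemma hom_inj f : {in edges S &, injective (on_edges f)}.
Proof.
move=> x y xS yS fxy; apply: (@leaves_above_inj S) => //; apply/fsetP => u.
have [ul|ul] := boolP (u \in leaves S); last by rewrite !leaves_aboveP (negPf ul).
have [z zu] := hom_leaf_pick f (leaf_edge ul).
by rewrite -!(hom_leaves_above _ ul zu) // fxy.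
Qed.

Lemma hom_anc f x y : x \in edges S -> y \in edges S ->
  anc S x y -> anc T (on_edges f x) (on_edges f y).
Proof.
move=> xS yS xy; apply: leaves_above_anc; try exact: app_edge.
apply/fsubsetP => z zy.
have := op_count (tree_hom_op f (op_leaves_above yS)) z; rewrite count_map zy => c.
have /hasP[u uy /= zu] :
    has (preim (on_edges f) (fun x => z \in L x)) (leaves_above S y).
  by rewrite has_count c.
have ul : u \in leaves S by have := uy; rewrite leaves_aboveP => /andP[].
by rewrite (hom_leaves_above _ ul zu) //; exact: (fsubsetP (leaves_above_sub xy)).
Qed.

(** By [count_op] only leaf counts matter, and the count at a leaf [u] of [S] equals that at a leaf
    of [T] above its image. *)
Lemma hom_reflects_op f s e : e \in edges S -> {subset s <= edges S} ->
  tree_op T (map (on_edges f) s) (on_edges f e) -> tree_op S s e.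
Proof.
move=> eS sS o; apply: count_op => // u.
have [ul|ul] := boolP (u \in leaves S); last first.
  rewrite leaves_aboveP (negPf ul) /= (@eq_count _ _ pred0) ?count_pred0 //.
  by move=> x; rewrite leaves_aboveP (negPf ul).
have [z zu] := hom_leaf_pick f (leaf_edge ul).
rewrite -(hom_leaves_above _ ul zu) // -(op_count o z) count_map.
by apply: eq_in_count => x /sS xS /=; rewrite (hom_leaves_above _ ul zu).
Qed.

Lemma hom_mono R f (h k : tree_hom R S) : tree_comp f h = tree_comp f k -> h = k.
Proof.
move=> fhk; apply: tree_homP => x xR; apply: (@hom_inj f); try exact: app_edge.
by rewrite -!app_comp //; congr on_edges; exact: (congr1 (@edge_map _ _) fhk).
Qed.

End ReducedHom.

(** The edgewise lift is a morphism because [f'] reflects operations. *)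
Lemma hom_lift (S S' T : rtree) (f : tree_hom S T) (f' : tree_hom S' T) :
  (forall x, x \in edges S ->
     exists2 x', x' \in edges S' & on_edges f' x' = on_edges f x) ->
  exists h : tree_hom S S', tree_comp f' h = f.
Proof.
move=> H.
have Hx (x : edges S) : exists y : edges S', on_edges f' (val y) = on_edges f (val x).
  by have [y yS' E] := H _ (valP x); exists [` yS'].
pose h0 : {ffun edges S -> edges S'} := [ffun x => sval (cid (Hx x))].
have h0E x : x \in edges S -> on_edges f' (on_edges h0 x) = on_edges f x.
  by move=> xS; rewrite -[x]/(val [` xS]) app_val ffunE; case: cid.
have h0P : `[< preserves_op h0 >].
  apply/asboolP => s e o; have [eS sS] := op_edges o.
  apply: (@hom_reflects_op _ _ f'); first exact: app_edge.
    by move=> _ /mapP[x /sS xS ->]; exact: app_edge.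
  rewrite h0E // -map_comp (eq_in_map (on_edges f' \o on_edges h0) (on_edges f) s).1.
    exact: tree_hom_op.
  by move=> x /sS xS /=; exact: h0E.
exists (TreeHom h0P); apply: tree_homP => x xS.
by rewrite app_comp // h0E.
Qed.

(** The root and the leaves of [T] are all images under [a], and there [g] is known through [b]. *)
Lemma A_cancel (S T U : tree) (g : tree_hom T U) (a : A_hom S T) (b : A_hom S U) :
  tree_comp g a = b -> root_leaves g.
Proof.
case: a b => [a /= /asboolP[ar al ai as_]] [b /= /asboolP[br bl bi bs]] gab.
have E x : x \in edges S -> on_edges g (on_edges a x) = on_edges b x.
  by move=> xS; rewrite -gab app_comp.
split=> [|x /as_[y yS <-]|x y /as_[x' xS <-] /as_[y' yS <-]|y /bs[x xS <-]].
- by rewrite -ar E ?root_edge.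
- by rewrite E ?leaf_edge // bl.
- by rewrite !E ?leaf_edge // => /bi ->.
- by exists (on_edges a x); [exact: al|rewrite E ?leaf_edge].
Qed.

(** * The subtree spanned by an operation *)

Lemma inputs_corolla l : inputs (corolla l) l = [fset x in iota 0 l].
Proof. by apply/fsetP => x; rewrite corolla_inputs eqxx andbT in_fset /= mem_iota. Qed.

(** Makes the corolla an [rtree], so that the results on morphisms of reduced trees apply to
    operations. *)
Lemma corolla_reduced l : 2 <= l -> reduced (corolla l).
Proof.
move=> l2 v; rewrite /= inE => /eqP ->; rewrite inputs_corolla.
by rewrite card_fseq undup_id ?iota_uniq // size_iota.
Qed.

Section Hull.
Variables (T : rtree) (l : nat) (l2 : 2 <= l) (g : tree_hom (corolla l) T).
Let C := RTree (corolla_reduced l2).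
Let gC : tree_hom C T := g.
Local Notation G := (on_edges g).

Let ord_edge (i : 'I_l) : (i : nat) \in edges C.
Proof. by rewrite corolla_edges ltnW. Qed.
Let ord_leaf (i : 'I_l) : (i : nat) \in leaves C.
Proof. by rewrite corolla_leaves. Qed.
Let root_in : l \in edges C.
Proof. by rewrite corolla_edges. Qed.

Lemma corolla_hom_anc_root (i : 'I_l) : anc T (G l) (G i).
Proof. by apply: (@hom_anc C T gC) => //; apply: root_anc. Qed.

(** A leaf of [T] above [G j] is then above [G i] too, but it detects only the corolla leaf [j]. *)
Lemma corolla_hom_antichain (i j : 'I_l) : anc T (G i) (G j) -> i = j.
Proof.
move=> ij; have [z zj] := @hom_leaf_pick C T gC j (ord_edge j).
have := fsubsetP (leaves_above_sub ij) _ zj.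
rewrite (@hom_leaves_above C T gC _ j) // leaves_above_leaf // inE.
by move=> /eqP/val_inj.
Qed.

Lemma corolla_hom_cover z : z \in leaves_above T (G l) ->
  exists i : 'I_l, z \in leaves_above T (G i).
Proof.
move=> zl; have lv : l \in vert (corolla l) by rewrite /= inE.
have := op_count (tree_hom_op g (op_vertex lv)) z; rewrite count_map zl => c.
have /hasP[x] :
    has (preim G (fun x => z \in leaves_above T x)) (inputs (corolla l) l).
  by rewrite has_count c.
by rewrite corolla_inputs => /andP[xl _] zx; exists (Ordinal xl).
Qed.

Definition hull_edges : {fset nat} :=
  [fset x in edges T | anc T (G l) x && [exists i : 'I_l, anc T x (G i)]].
Definition hull_vert : {fset nat} :=
  [fset x in hull_edges | [forall i : 'I_l, x != G i]].

Lemma hull_edgesP x : reflect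
  [/\ x \in edges T, anc T (G l) x & exists i : 'I_l, anc T x (G i)]
  (x \in hull_edges).
Proof.
have -> : (x \in hull_edges) = [&& x \in edges T, anc T (G l) x &
    [exists i : 'I_l, anc T x (G i)]] by rewrite !inE.
by apply: (iffP and3P) => -[xT xl H]; split=> //; exact/existsP.
Qed.

Lemma hull_vertP x : reflect
  (x \in hull_edges /\ forall i : 'I_l, x != G i) (x \in hull_vert).
Proof. have -> : (x \in hull_vert) = (x \in hull_edges) && [forall i : 'I_l, x != G i].
  by rewrite !inE.
by apply: (iffP andP) => -[xS H]; split=> //; exact/forallP. Qed.

Lemma hull_vert_edges : {subset hull_vert <= hull_edges}.
Proof. by move=> x /hull_vertP[]. Qed.

Lemma hull_root : G l \in hull_edges.
Proof.
apply/hull_edgesP; split; [exact: (app_edge gC)|exact: anc_refl|].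
by exists (Ordinal (ltnW l2)); exact: corolla_hom_anc_root.
Qed.

Lemma hull_tip (i : 'I_l) : G i \in hull_edges.
Proof.
apply/hull_edgesP; split; [exact: (app_edge gC)|exact: corolla_hom_anc_root|].
by exists i; exact: anc_refl.
Qed.

Lemma hull_root_vert : G l \in hull_vert.
Proof.
apply/hull_vertP; split=> [|i]; first exact: hull_root.
apply/eqP => /(@hom_inj C T gC) li.
by have := ltn_ord i; rewrite -li ?ltnn.
Qed.

Lemma hull_vert_vert x : x \in hull_vert -> x \in vert T.
Proof.
move=> /hull_vertP[/hull_edgesP[xT _ [i xi]] ne].
have [w /inputs_vert//] := anc_input (app_edge gC (ord_edge i)) xi (ne i).
Qed.

Lemma hull_up x : x \in hull_edges -> x != G l -> x != troot T.
Proof.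
move=> /hull_edgesP[xT lx _]; apply: contra_neq => xr.
move: lx; rewrite xr => lr.
apply: (anc_antisym (app_edge gC root_in)) => //.
by apply: root_anc; exact: (app_edge gC).
Qed.

Lemma hull_below x : x \in hull_edges -> x != G l -> below T x \in hull_vert.
Proof.
move=> xS xl; have xr := hull_up xS xl.
have uE : up T x = below T x by rewrite /up (negPf xr).
have /hull_edgesP[xT lx [i xi]] := xS.
have bS : below T x \in hull_edges.
  apply/hull_edgesP; split; first by rewrite -uE up_edge.
    by rewrite -uE; apply: anc_strict => //; rewrite eq_sym.
  by exists i; rewrite -uE; apply: anc_trans (anc_up T x) xi.
apply/hull_vertP; split=> // j; apply: contraTneq (below_neq xT xr) => bj.
have jx : anc T (G j) x by rewrite -bj -uE anc_up.
(* A tip [G j] just below [x] would be below the tip [G i]; then they coincide and [x] is squeezed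
   between them. *)
have ij := corolla_hom_antichain (anc_trans jx xi).
by rewrite bj negbK; apply/eqP/(anc_antisym xT) => //; rewrite ij.
Qed.

Lemma hull_to_root x : x \in hull_edges -> exists k, iter k (below T) x = G l.
Proof. by move=> /hull_edgesP[_ + _]; exact: anc_iter_below. Qed.

(** The subtree of [T] whose root and leaves are the images under [g] of those
of the corolla. *)
Definition hull_tree : tree := Tree hull_root hull_vert_edges hull_below hull_to_root.

(** A leaf above the input [x] is above some tip [G i]. Were [G i] strictly below [x], it would be
    below [v], hence below the tip above [v]; the antichain property would make [v] a tip. *)
Lemma hull_inputs v : v \in hull_vert -> inputs hull_tree v = inputs T v.
Proof.
move=> vV; apply/fsetP => x; apply/idP/idP => [|xv].
  rewrite inputsP => /and3P[xS xl bx].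
  by rewrite inputsP bx (hull_up xS xl); have /hull_edgesP[->] := xS.
have /hull_vertP[/hull_edgesP[vT lv [j vj]] ne] := vV.
have vx := input_anc xv; have [xT ux nxv] := input_up xv.
have [z zx] := leaves_above_nonempty xT.
have lx := anc_trans lv vx.
have [i zi] := corolla_hom_cover (fsubsetP (leaves_above_sub lx) _ zx).
have xi : anc T x (G i).
  move: zx zi; rewrite !leaves_aboveP => /andP[_ xz] /andP[_ iz].
  have /orP[//|ix] := anc_total xz iz.
  have [<-|nix] := eqVneq (G i) x; first exact: anc_refl.
  have iv := anc_strict ix nix; rewrite ux in iv.
  have := ne i; rewrite -(anc_antisym vT iv) ?eqxx //.
  by rewrite (corolla_hom_antichain (anc_trans iv vj)).
have /and3P[_ _ bx] : [&& x \in edges T, x != troot T & below T x == v].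
  by rewrite -inputsP.
rewrite inputsP bx andbT; apply/andP; split.
  by apply/hull_edgesP; split=> //; exists i.
by apply: contraNneq nxv => xl; apply/eqP/(anc_antisym vT) => //; rewrite xl.
Qed.

Lemma hull_reduced : reduced hull_tree.
Proof.
move=> v vV; rewrite hull_inputs //; apply: (@rtree_reduced T).
exact: hull_vert_vert.
Qed.

Definition hull : rtree := RTree hull_reduced.

Lemma hull_edge_edge (x : edges hull) : val x \in edges T.
Proof. by have /hull_edgesP[] := valP x. Qed.

Let incl := [ffun x : edges hull => [` hull_edge_edge x] : edges T].

Lemma app_span_incl x : on_edges incl x = x.
Proof. by rewrite /on_edges; case: insubP => //= y _ <-; rewrite ffunE. Qed.

Lemma hull_incl_op : `[< preserves_op incl >].
Proof.
apply/asboolP/preserves_vertex => v vV.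
rewrite app_span_incl (eq_map app_span_incl) map_id hull_inputs //.
by apply: op_vertex; exact: hull_vert_vert.
Qed.
Definition hull_incl : tree_hom hull T := TreeHom hull_incl_op.

(** The image of [g] lies in the hull, so [g] lifts along the inclusion; a hull edge that is not a
    vertex is a tip. *)
Lemma hull_mark : exists a : A_hom (corolla l) hull, tree_comp hull_incl a = g.
Proof.
have [|a aE] := @hom_lift C hull T gC hull_incl.
  move=> x; rewrite corolla_edges leq_eqVlt => /predU1P[->|xl].
    by exists (G l); [exact: hull_root|exact: app_span_incl].
  by exists (G x); [exact: (hull_tip (Ordinal xl))|exact: app_span_incl].
have ax x : x <= l -> on_edges a x = G x.
  move=> xl; rewrite -[g]aE app_comp ?corolla_edges //.
  by rewrite [RHS]app_span_incl.
suff aP : `[< root_leaves a >] by exists (AHom aP).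
have tip_leaf (i : 'I_l) : G i \in leaves hull.
  by rewrite in_fsetD hull_tip andbT; apply/hull_vertP => -[_ /(_ i)]; rewrite eqxx.
apply/asboolP; split=> [|x|x y|y].
- exact: ax.
- rewrite corolla_leaves => xl; rewrite ax ?(ltnW xl) //.
  exact: (tip_leaf (Ordinal xl)).
- by move=> /leaf_edge xC /leaf_edge yC; exact: (@hom_inj C hull a).
- rewrite in_fsetD => /andP[/hull_vertP yV yS].
  have [i yi] : exists i : 'I_l, y = G i.
    apply: contrapT => H; apply: yV; split=> // i.
    by apply/eqP => yi; apply: H; exists i.
  by exists (i : nat); [exact: ord_leaf|rewrite ax ?(ltnW (ltn_ord i))].
Qed.

Variables (S : rtree) (a : A_hom (corolla l) S) (f : tree_hom S T).
Hypothesis fa : tree_comp f a = g.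

Let faE x : x <= l -> on_edges f (on_edges a x) = G x.
Proof. by move=> xl; rewrite -fa app_comp ?corolla_edges. Qed.

Let aroot : on_edges a l = troot S.
Proof. by have /asboolP[] := valP a. Qed.

Let aleaf x : x \in leaves S -> exists i : 'I_l, on_edges a i = x.
Proof.
have /asboolP[_ _ _ as_] := valP a; move=> /as_[y + <-].
by rewrite corolla_leaves => yl; exists (Ordinal yl).
Qed.

Let al (i : 'I_l) : on_edges a i \in leaves S.
Proof. by have /asboolP[_ + _ _] := valP a; apply. Qed.

Lemma hull_image x : x \in edges S -> on_edges f x \in hull_edges.
Proof.
move=> xS; apply/hull_edgesP; split; first exact: app_edge.
  rewrite -(faE (leqnn l)) aroot.
  by apply: hom_anc; [exact: root_edge| |exact: root_anc].
have [z] := leaves_above_nonempty xS; rewrite leaves_aboveP => /andP[zl xz].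
have [i iz] := aleaf zl; exists i; rewrite -(faE (ltnW (ltn_ord i))) iz.
by apply: hom_anc => //; exact: leaf_edge.
Qed.

(** Injectivity of [f] keeps inner edges away from the images of the root and the leaves, which are
    [G l] and the tips. *)
Lemma hull_image_inner x : x \in inner S -> on_edges f x \in inner hull.
Proof.
move=> xI; have xS := inner_edge xI; move: xI; rewrite !innerP => /andP[xr xV].
apply/andP; split.
  apply: contra_neq xr => fx; apply: (@hom_inj _ _ f); rewrite ?root_edge //.
  by rewrite fx -aroot faE.
apply/hull_vertP; split=> [|i]; first exact: hull_image.
apply/eqP; rewrite -(faE (ltnW (ltn_ord i))) => fxi.
have := al i; rewrite -(@hom_inj _ _ f _ _ xS (leaf_edge (al i)) fxi).
by rewrite inE xV.
Qed.

Lemma marked_edge x : x \in edges S -> x \notin inner S ->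
  exists2 y, y <= l & on_edges a y = x.
Proof.
move=> xS; rewrite innerP negb_and negbK => /orP[/eqP ->|xV]; first by exists l.
have [|i <-] := @aleaf x; first by rewrite inE xV.
by exists (i : nat) => //; exact: ltnW.
Qed.

End Hull.

(** * Marked trees over [T] up to isomorphism *)

Section Labels.
Variables (T : rtree) (l : nat).
Local Notation M := (restrict_A (free_presheaf (@representable Omega_r T))).
Local Notation hom := (tree_hom (corolla l) T).

(** The pair of [g] and [e] is a complete isomorphism invariant of an enumerated marked tree over
    [T]: see [labels_iso], and [labels_exist] for the values taken. *)
Record labels n (c : cell l n) (f : tree_hom (ctree c) T)
    (g : hom) (e : 'I_n -> nat) : Prop := Labels {
  label_mark : tree_comp f (cmark c) = g;
  label_enum : forall i, on_edges f (cenum c i) = e i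
}.

Definition hom_gen (S : rtree) (f : tree_hom S T) : M S :=
  @freeab_gen (@mor Omega_r S T) f.

Lemma hom_gen_map (S S' : rtree) (h : A_hom S S') (f : tree_hom S' T) :
  ap_map M (a := S) (b := S') h (hom_gen f) = hom_gen (tree_comp f h).
Proof. exact: (@free_map_gen _ (@representable Omega_r T) S S' h f). Qed.

(** An edge of [ctree c] is either inner, hence located in [T] by [e], or marked, hence located by
    [g]. So the image of [f] lies in that of [f'], and [hom_lift] applies. *)
Lemma labels_iso n (c c' : cell l n) f f' g e :
  @labels n c f g e -> @labels n c' f' g e ->
  exists h : A_hom (ctree c) (ctree c'),
    [/\ cmark c' = A_comp h (cmark c),
        forall i, cenum c' i = on_edges h (cenum c i) & tree_comp f' h = f].
Proof.
move=> [fg fe] [fg' fe'].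
have [|h hE] := @hom_lift _ _ _ f f'.
  move=> x xS; have [xI|xI] := boolP (x \in inner (ctree c)).
    have /cenum_inner[i <-] := xI; exists (cenum c' i); last by rewrite fe fe'.
    by apply: inner_edge; apply/cenum_inner; exists i.
  have [y yl <-] := marked_edge (cmark c) xS xI.
  have yC : y \in edges (corolla l) by rewrite corolla_edges.
  exists (on_edges (cmark c') y); first exact: app_edge.
  rewrite -!app_comp //.
  by move: fg'; rewrite -fg => /(congr1 (fun k : hom => on_edges k y)).
have hm : tree_comp h (cmark c) = cmark c'.
  by apply: (@hom_mono _ _ _ f'); rewrite tree_compA hE fg fg'.
have hA := A_cancel (U := ctree c') hm.
exists (AHom (introT (asboolP _) hA)); split=> //; first exact/val_inj/esym.
move=> i; apply: (@hom_inj _ _ f').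
- by apply: inner_edge; apply/cenum_inner; exists i.
- by apply: app_edge; apply: inner_edge; apply/cenum_inner; exists i.
- by rewrite fe' -fe -hE app_comp //; apply: inner_edge; apply/cenum_inner; exists i.
Qed.

Lemma labels_class n (c c' : cell l n) f f' g e :
  @labels n c f g e -> @labels n c' f' g e ->
  DC_class (M := M) (hom_gen f) = DC_class (M := M) (hom_gen f').
Proof.
move=> lc lc'; have [h [hm he hf]] := labels_iso lc lc'.
have [k [km ke kf]] := labels_iso lc' lc.
rewrite -{1}hf -hom_gen_map; apply: DC_class_iso => //; exists k; split; apply/val_inj.
  by apply: (@hom_mono _ _ _ f); rewrite tree_compA kf tree_compm1.
by apply: (@hom_mono _ _ _ f'); rewrite tree_compA hf tree_compm1.
Qed.

Lemma labels_face n (c : cell l n) f g e i : @labels n c f g e ->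
  labels (c := face c i) (tree_comp f (face_hom c i)) g (fun k => e (lift i k)).
Proof.
move=> [fg fe]; split=> [|k].
  rewrite -tree_compA -fg; congr tree_comp.
  by have /(congr1 (@A_tree_hom _ _)) := contract_markE (cenum_in c i) (cmark c).
rewrite app_comp; first by rewrite app_contract fe.
exact: inner_edge (cenum_in (face c i) k).
Qed.

Lemma labels_perm n (c : cell l n) f g e (t : {perm 'I_n}) : @labels n c f g e ->
  labels (c := cell_perm c t) f g (fun k => e (t k)).
Proof. by move=> [fg fe]; split=> // k; exact: fe. Qed.

Lemma labels_act n (c : cell l n) f g e (s : {perm 'I_l}) : @labels n c f g e ->
  labels (c := cell_act s c) f (tree_comp g (corolla_aut s)) e.
Proof. by move=> [fg fe]; split=> //; rewrite -fg -tree_compA. Qed.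

Lemma labels_inj n (c : cell l n) f g e : @labels n c f g e -> injective e.
Proof.
move=> [_ fe] i j; rewrite -!fe => /(@hom_inj _ _ f) H; apply: (@cenum_inj _ _ c).
by apply: H; apply: inner_edge; apply/cenum_inner; [exists i|exists j].
Qed.

Hypothesis l2 : 2 <= l.

Lemma labels_inner n (c : cell l n) f g e : @labels n c f g e ->
  forall i, e i \in inner (hull l2 g).
Proof.
move=> [fg fe] i; rewrite -fe; apply: (hull_image_inner l2 fg).
by apply/cenum_inner; exists i.
Qed.

(** Induction on the number of inner edges of the hull missed by [e]. If none is missed, the hull
    serves; otherwise a missed edge is added to [e] at position 0 and contracted afterwards. *)
Lemma labels_exist n (g : hom) (e : 'I_n -> nat) : injective e ->
  (forall i, e i \in inner (hull l2 g)) ->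
  exists (c : cell l n) f, @labels n c f g e.
Proof.
have [m] := ubnP (#|` inner (hull l2 g)| - n).
elim: m n e => // m IH n e lt_m einj eI.
have [|sub] := boolP (inner (hull l2 g) `<=` [fset x in codom e]).
  move=> sub; have [a aE] := hull_mark l2 g.
  have vne : vert (hull l2 g) != fset0.
    by apply/fset0Pn; exists (on_edges g l); exact: hull_root_vert.
  have eP x : x \in inner (hull l2 g) <-> exists i, e i = x.
    split=> [/(fsubsetP sub)|[i <-]]; last exact: eI.
    by rewrite in_fset => /codomP[i ->]; exists i.
  exists (@Cell l n (hull l2 g) vne a e einj eP), (hull_incl l2 g).
  by split=> // i; rewrite [LHS]app_span_incl.
move: sub => /fsubsetPn[x xI]; rewrite in_fset => xe.
pose e' (i : 'I_n.+1) := if unlift ord0 i is Some j then e j else x.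
have e'l k : e' (lift ord0 k) = e k by rewrite /e' liftK.
have e'0 : e' ord0 = x by rewrite /e' unlift_none.
have e'inj : injective e'.
  move=> i j; case: (unliftP ord0 i) => [i' ->|->];
    case: (unliftP ord0 j) => [j' ->|->] //;
    rewrite ?e'l ?e'0.
  - by move=> /einj ->.
  - by move=> E; case/codomP: xe; exists i'.
  - by move=> E; case/codomP: xe; exists j'.
have e'I i : e' i \in inner (hull l2 g).
  by case: (unliftP ord0 i) => [i' ->|->]; rewrite ?e'l ?e'0.
(* Makes the truncated difference drop; [e'] has [n.+1] distinct values among the inner edges. *)
have n_lt : n < #|` inner (hull l2 g)|.
  have : [fset y in codom e'] `<=` inner (hull l2 g).
    by apply/fsubsetP => y; rewrite in_fset => /codomP[i ->].
  move=> /fsubset_leq_card; rewrite card_fseq undup_id; last first.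
    by rewrite map_inj_uniq ?enum_uniq.
  by rewrite size_codom card_ord.
have [|c [f lf]] := IH _ e' _ e'inj e'I; first by lia.
exists (face c ord0), (tree_comp f (face_hom c ord0)).
have [fg fe] := labels_face ord0 lf; split=> // i.
by rewrite fe e'l.
Qed.

End Labels.

(** * The contracting homotopy *)

Local Open Scope ring_scope.

Section Chains.
Variables (T : rtree) (l : nat).
Local Notation M := (restrict_A (free_presheaf (@representable Omega_r T))).
Local Notation hom := (tree_hom (corolla l) T).
Local Notation DC := (DC M l).

Definition labelled_cell n (g : hom) (e : 'I_n -> nat) : Prop :=
  exists p : {c : cell l n & tree_hom (ctree c) T}, labels (projT2 p) g e.

(** The chain of any marked tree over [T] with composite marking [g] whose inner
edges are enumerated by [e] in [T]; zero if there is none. *)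
Definition chain n (g : hom) (e : 'I_n -> nat) : DC n :=
  if pselect (labelled_cell g e) is left H
  then DC_class (M := M) (hom_gen (projT2 (projT1 (cid H)))) else 0.

Lemma chain_class n (c : cell l n) f g e : @labels T l n c f g e ->
  DC_class (M := M) (hom_gen f) = chain g e.
Proof.
move=> lf; rewrite /chain; case: pselect => [H|[]]; last first.
  by exists (existT _ c f).
by case: (cid H) => p /= lp; exact: labels_class lf lp.
Qed.

Lemma chain_out n g (e : 'I_n -> nat) : ~ labelled_cell g e -> chain g e = 0.
Proof. by move=> H; rewrite /chain; case: pselect. Qed.

Lemma chain_non_inj n g (e : 'I_n -> nat) : ~ injective e -> chain g e = 0.
Proof. by move=> H; apply: chain_out => -[[c f] /labels_inj]. Qed.

Lemma chain_perm n g (e : 'I_n -> nat) (t : {perm 'I_n}) :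
  chain g (fun i => e (t i)) = chain g e *~ (-1) ^+ t.
Proof.
have [[[c f] /= lf]|H] := pselect (labelled_cell g e).
  by rewrite -(chain_class lf) -(chain_class (labels_perm t lf)) DC_class_sgn.
(* Permuting back shows that a reordering of [e] is labelled only if [e] is, so both sides are the
   default zero. *)
rewrite !chain_out ?mul0rz // => -[[c f] /= /(labels_perm t^-1)] lf; apply: H.
exists (existT _ (cell_perm c t^-1) f); case: lf => fg fe; split=> //= i.
by rewrite fe permKV.
Qed.

Lemma chain_d n g (e : 'I_n -> nat) : labelled_cell g e ->
  DC_d (chain g e) = \sum_(i < n) chain g (fun k => e (lift i k)) *~ (-1) ^+ i.
Proof.
move=> [[c f] /= lf]; rewrite -(chain_class lf) DC_d_class.
apply: eq_bigr => i _; rewrite -(chain_class (labels_face i lf)).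
by rewrite -(@hom_gen_map T (ctree (face c i)) (ctree c) (face_hom c i)).
Qed.

(** The chains generate: a generator [f] on a cell [c] is labelled by its composite marking and the
    images of the inner edges. *)
Lemma chain_ind n (P : DC n -> Prop) : P 0 ->
  (forall u v, P u -> P v -> P (u - v)) ->
  (forall g e, labelled_cell g e -> P (chain g e)) -> forall u, P u.
Proof.
move=> P0 PB Pc.
have PN u : P u -> P (- u) by move=> Pu; rewrite -sub0r; exact: PB.
have PD u v : P u -> P v -> P (u + v).
  by move=> Pu Pv; rewrite -[v]opprK; apply: PB => //; exact: PN.
have PMn u k : P u -> P (u *+ k).
  by move=> Pu; elim: k => [|k IH]; rewrite ?mulr0n ?mulrS //; exact: PD.
elim/DC_ind=> // c x.
have DC_additive : zmod_morphism (@DC_class M l n c) by exact: DC_class_zmod.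
pose add := GRing.isZmodMorphism.Build _ _ _ DC_additive.
pose dcl : {additive M (ctree c) -> DC n} := HB.pack (@DC_class M l n c) add.
rewrite -[DC_class x]/(dcl x).
elim/dsum_ind: x => [|x y Px Py|f k]; first by rewrite raddf0.
  by rewrite raddfD; exact: PD.
rewrite freeab_genE raddfMz /=.
have Pf : P (DC_class (M := M) (hom_gen f)).
  have lf : labels f (tree_comp f (cmark c)) (fun i => on_edges f (cenum c i)) by [].
  by rewrite (chain_class lf); apply: Pc; exists (existT _ c f).
by case: k => k; [exact: PMn|exact/PN/PMn].
Qed.

(** * Homomorphisms out of the chain groups *)

Section Extend.
Variables (n : nat) (W : zmodType) (F : hom -> ('I_n -> nat) -> W).
Hypothesis F_perm : forall g e (t : {perm 'I_n}),
  F g (fun i => e (t i)) = F g e *~ (-1) ^+ t.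

Definition extend_cell (c : cell l n) : M (ctree c) -> W :=
  dsum_lift (fun (f : tree_hom (ctree c) T) k =>
    F (tree_comp f (cmark c)) (fun i => on_edges f (cenum c i)) *~ k).

Lemma extend_cell_zmod c : zmod_morphism (@extend_cell c).
Proof. by apply: dsum_lift_zmod => f j k; rewrite mulrzBr. Qed.
HB.instance Definition _ c := GRing.isZmodMorphism.Build _ _ (@extend_cell c)
  (@extend_cell_zmod c).

Lemma extend_cell_gen c f :
  extend_cell (hom_gen f) = F (tree_comp f (cmark c)) (fun i => on_edges f (cenum c i)).
Proof.
by rewrite /extend_cell dsum_lift_inj ?mulr1z // => k j m; rewrite mulrzBr.
Qed.

Definition extend_sum : DC_sum M l n -> W :=
  dsum_lift (fun c : {classic cell l n} => @extend_cell c).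
Lemma extend_sum_zmod : zmod_morphism extend_sum.
Proof. by apply: dsum_lift_zmod => c; exact: extend_cell_zmod. Qed.
HB.instance Definition _ := GRing.isZmodMorphism.Build _ _ extend_sum extend_sum_zmod.

Lemma extend_sum_gen c x : extend_sum (DC_gen x) = @extend_cell c x.
Proof. by apply: dsum_lift_inj => c'; exact: extend_cell_zmod. Qed.

(** The isomorphism relation equates terms with equal labels, and the sign relation is [F_perm]. *)
Lemma extend_rel r : @DC_rel M l n r -> extend_sum r = 0.
Proof.
case=> [c c' h x _ hm he|c t x]; rewrite raddfB ?raddfMz /= !extend_sum_gen.
  apply/eqP; rewrite subr_eq0; apply/eqP.
  elim/dsum_ind: x => [|x y IHx IHy|f k]; first by rewrite !raddf0.
    by rewrite !raddfD /= IHx IHy.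
  rewrite freeab_genE !raddfMz /=; congr (_ *~ _).
  rewrite [X in extend_cell X](@hom_gen_map T (ctree c) (ctree c') h f).
  rewrite extend_cell_gen [RHS]extend_cell_gen hm /= tree_compA; congr F.
  apply: functional_extensionality_dep => i; rewrite he app_comp //.
  by apply: inner_edge; apply/cenum_inner; exists i.
apply/eqP; rewrite mulNrz subr_eq0; apply/eqP.
elim/dsum_ind: x => [|x y IHx IHy|f k]; first by rewrite !raddf0 mul0rz.
  by rewrite !raddfD /= IHx IHy mulrzDl.
rewrite freeab_genE !raddfMz /= mulrzAC; congr (_ *~ _).
rewrite extend_cell_gen [extend_cell _](@extend_cell_gen (cell_perm c t)) /=.
by rewrite (F_perm _ (fun i => on_edges f (cenum c i))) -mulrzA -signr_addb addbb.
Qed.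

Definition extend : DC n -> W := quot_lift extend_sum.
Lemma extend_zmod : zmod_morphism extend.
Proof. exact: quot_lift_zmod extend_rel. Qed.

Lemma extend_chain g e : labelled_cell g e -> extend (chain g e) = F g e.
Proof.
move=> [[c f] /= lf]; rewrite -(chain_class lf) /extend.
rewrite (quot_lift_pi extend_rel) /= extend_sum_gen extend_cell_gen.
case: lf => -> fe; congr F; exact: functional_extensionality_dep.
Qed.
End Extend.

(** * Coning from an inner edge *)

Hypothesis l2 : (2 <= l)%N.
Local Notation inner_of g := (inner (hull l2 g)).

(** The cone point depends on [g] alone, so a marked tree shares it with all its faces. *)
Definition pivot (g : hom) : nat := head 0%N (inner_of g).

Definition cons_enum n (x : nat) (e : 'I_n -> nat) (i : 'I_n.+1) : nat :=
  if unlift ord0 i is Some j then e j else x.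

Lemma cons_enum0 n x (e : 'I_n -> nat) : cons_enum x e ord0 = x.
Proof. by rewrite /cons_enum unlift_none. Qed.

Lemma cons_enumS n x (e : 'I_n -> nat) i : cons_enum x e (lift ord0 i) = e i.
Proof. by rewrite /cons_enum liftK. Qed.

Lemma cons_enumP n x (e : 'I_n -> nat) h :
  h ord0 = x -> (forall i, h (lift ord0 i) = e i) -> h = cons_enum x e.
Proof.
move=> h0 hS; apply: functional_extensionality_dep => i.
by case: (unliftP ord0 i) => [j ->|->]; rewrite ?cons_enum0 ?cons_enumS.
Qed.

(** Zero when the pivot is already in [e], and when [inner_of g] is empty, the junk
pivot [0] then not being an inner edge. *)
Definition cone n (g : hom) (e : 'I_n -> nat) : DC n.+1 :=
  chain g (cons_enum (pivot g) e).

(** Extending [t] by a fixed point at 0 keeps its sign. *)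
Lemma cone_perm n g (e : 'I_n -> nat) (t : {perm 'I_n}) :
  cone g (fun i => e (t i)) = cone g e *~ (-1) ^+ t.
Proof.
rewrite /cone.
have -> : cons_enum (pivot g) (fun i => e (t i)) =
    (fun i => cons_enum (pivot g) e (lift_perm ord0 ord0 t i)).
  apply/esym/cons_enumP => [|i]; first by rewrite lift_perm_id cons_enum0.
  by rewrite lift_perm_lift cons_enumS.
by rewrite chain_perm odd_lift_perm.
Qed.

Definition homotopy n : DC n -> DC n.+1 := extend (@cone n).
Lemma homotopy_zmod n : zmod_morphism (@homotopy n).
Proof. exact: extend_zmod (@cone_perm n). Qed.
HB.instance Definition _ n :=
  GRing.isZmodMorphism.Build _ _ (@homotopy n) (@homotopy_zmod n).

Lemma homotopy_chain n g (e : 'I_n -> nat) :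
  labelled_cell g e -> homotopy (chain g e) = cone g e.
Proof. exact: extend_chain (@cone_perm n) g e. Qed.

Lemma labelled_inner n g (e : 'I_n -> nat) : labelled_cell g e ->
  forall i, e i \in inner_of g.
Proof. by move=> [[c f] /= lf]; exact: labels_inner lf. Qed.

Lemma labelled_cons n g (e : 'I_n -> nat) : labelled_cell g e ->
  inner_of g != fset0 -> (forall i, e i != pivot g) ->
  labelled_cell g (cons_enum (pivot g) e).
Proof.
move=> le ne ep; have eI := labelled_inner le.
have [c [f lf]] : exists (c : cell l n.+1) f, @labels T l _ c f g (cons_enum (pivot g) e).
  apply: (labels_exist (l2 := l2)) => [i j|i].
    case: (unliftP ord0 i) => [i' ->|->]; case: (unliftP ord0 j) => [j' ->|->];
      rewrite ?cons_enum0 ?cons_enumS //.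
    - by have [[c f] /= /labels_inj einj] := le; move=> /einj ->.
    - by move=> /eqP; rewrite (negPf (ep _)).
    - by move=> /eqP; rewrite eq_sym (negPf (ep _)).
  case: (unliftP ord0 i) => [i' ->|->]; rewrite ?cons_enum0 ?cons_enumS //.
  have /fset0Pn[x] := ne; rewrite /pivot -[_ \in _]/(x \in (inner_of g : seq nat)).
  rewrite -[(head _ _ \in _) : bool]/(head 0%N (inner_of g) \in (inner_of g : seq nat)).
  by case: (inner_of g : seq nat) => //= y s _; rewrite mem_head.
by exists (existT _ c f).
Qed.

Lemma labelled_face n g (e : 'I_n -> nat) i : labelled_cell g e ->
  labelled_cell g (fun k => e (lift i k)).
Proof.
move=> [[c f] /= /(labels_face i) lf].
by exists (existT _ (face c i) (tree_comp f (face_hom c i))).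
Qed.

(** The cone has the pivot as its only inner edge, and contracting it returns the chain. *)
Lemma homotopy0 g (e : 'I_0 -> nat) : labelled_cell g e -> inner_of g != fset0 ->
  DC_d (homotopy (chain g e)) = chain g e.
Proof.
move=> le ne; rewrite homotopy_chain // chain_d; last first.
  by apply: labelled_cons => // -[].
rewrite big_ord_recl big_ord0 addr0 expr0 mulr1z; congr chain.
by apply: functional_extensionality_dep => -[].
Qed.

Lemma homotopyS n (u : DC n.+1) : DC_d (homotopy u) + homotopy (DC_d u) = u.
Proof.
elim/chain_ind: u => [|u v IHu IHv|g e le]; first by rewrite !raddf0 addr0.
  by rewrite !raddfB /= -{3}IHu -{3}IHv addrACA -opprD.
have ne : inner_of g != fset0.
  by apply/fset0Pn; exists (e ord0); exact: labelled_inner.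
have dE : homotopy (DC_d (chain g e)) =
    \sum_(i < n.+1) cone g (fun k => e (lift i k)) *~ (-1) ^+ i.
  rewrite chain_d // raddf_sum; apply: eq_bigr => i _.
  by rewrite raddfMz /= homotopy_chain; last exact: (labelled_face i le).
rewrite dE homotopy_chain //.
(* If the pivot is [e j], the cone repeats an edge and vanishes, as do the cones on all faces except
   the one omitting [j]. *)
have [/existsP[j /eqP ej]|/existsPn ep] := boolP [exists j, e j == pivot g].
  rewrite /cone (@chain_non_inj _ g (cons_enum _ e)) ?raddf0 ?add0r; last first.
    by move=> /(_ ord0 (lift ord0 j)); rewrite cons_enum0 cons_enumS ej => /(_ erefl).
  rewrite (bigD1 j) //= big1 ?addr0 => [|i ij]; last first.
    rewrite chain_non_inj ?mul0rz // => einj.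
    have [k kE|E] := unliftP i j; last by rewrite E eqxx in ij.
    have := einj ord0 (lift ord0 k); rewrite cons_enum0 cons_enumS -kE ej.
    by move=> /(_ erefl).
  (* The surviving cone is [e] with position [j] moved to the front, a reordering whose sign cancels
     [(-1) ^+ j]. *)
  rewrite -(cons_enumP (h := fun i => e (lift_perm ord0 j 1%g i))).
  - rewrite chain_perm -mulrzA -[(-1) ^+ j]signr_odd -signr_addb.
    by rewrite odd_lift_perm odd_perm1 /= addbF addbb mulr1z.
  - by rewrite lift_perm_id.
  - by move=> i; rewrite lift_perm_lift perm1.
(* Otherwise face 0 of the cone gives [e] back, and face [i + 1] is the cone on face [i] with
   opposite sign. *)
rewrite chain_d; last exact: labelled_cons.
rewrite big_ord_recl expr0 mulr1z -addrA -big_split /= big1 ?addr0 => [|i _].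
  by congr chain; apply: functional_extensionality_dep => i; rewrite cons_enumS.
have -> : (fun k : 'I_n.+1 => cons_enum (pivot g) e (lift (lift ord0 i) k)) =
    cons_enum (pivot g) (fun k => e (lift i k)).
  apply: cons_enumP => [|k].
    by rewrite -[RHS](cons_enum0 _ e); congr cons_enum; apply: val_inj.
  rewrite -(cons_enumS (pivot g) e); congr cons_enum.
  by apply: val_inj; rewrite /= /bump /= !add1n ltnS addnS.
by rewrite /cone /= /bump add1n exprS mulN1r mulrNz addNr.
Qed.

End Chains.

(** * Corollas of the vertices of [T] *)

Section Corollas.
Variables (T : rtree) (l : nat) (l2 : (2 <= l)%N).
Variable b : forall v : Vert T l, numbering l (Vert_inputs v).
Local Notation M := (restrict_A (free_presheaf (@representable Omega_r T))).
Local Notation hom := (tree_hom (corolla l) T).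
Local Notation DC := (DC M l).
Local Notation inner_of g := (inner (hull l2 g)).

Section VertexHom.
Variables (v : Vert T l) (t : {perm Vert_inputs v}).

Definition vertex_hom_fun (x : nat) : nat :=
  if insub x is Some i then val (t (b v i)) else val (val v).

Lemma vertex_hom_ord (i : 'I_l) : vertex_hom_fun i = val (t (b v i)).
Proof. by rewrite /vertex_hom_fun valK. Qed.

Lemma vertex_hom_root : vertex_hom_fun l = val (val v).
Proof. by rewrite /vertex_hom_fun insubF ?ltnn. Qed.

Lemma vertex_hom_edge (x : edges (corolla l)) : vertex_hom_fun (val x) \in edges T.
Proof.
rewrite /vertex_hom_fun; case: insubP => [i _ _|_].
  by have /input_up[] := valP (t (b v i)).
by apply: vert_edge; exact: valP.
Qed.

Let f := [ffun x : edges (corolla l) => [` vertex_hom_edge x]].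

Let fE x : (x <= l)%N -> on_edges f x = vertex_hom_fun x.
Proof.
by rewrite -corolla_edges => xl; rewrite -[x]/(val [` xl]) app_val ffunE.
Qed.

Let f_ord (i : 'I_l) : on_edges f i = val (t (b v i)).
Proof. by rewrite fE ?vertex_hom_ord // ltnW. Qed.

Let f_root : on_edges f l = val (val v).
Proof. by rewrite fE ?vertex_hom_root. Qed.

Lemma vertex_hom_op : `[< preserves_op f >].
Proof.
apply/asboolP/preserves_vertex => u; rewrite /= inE => /eqP ->.
rewrite f_root; apply: op_perm (op_vertex (valP (val v))).
have ordE x : x \in inputs (corolla l) l -> exists i : 'I_l, x = i.
  by rewrite corolla_inputs => /andP[xl _]; exists (Ordinal xl).
apply: uniq_perm; rewrite ?fset_uniq //.
  rewrite map_inj_in_uniq ?fset_uniq // => x y /ordE[i ->] /ordE[j ->].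
  rewrite !f_ord => /val_inj/perm_inj/(can_inj (@nb_funK _ _ (b v))) -> //.
move=> x; apply/idP/mapP => [xv|[y /ordE[i ->] ->]]; last first.
  by rewrite f_ord; exact: valP.
exists (nb_inv (b v) ((t^-1)%g [` xv]) : nat).
  by rewrite corolla_inputs ltn_ord eqxx.
by rewrite f_ord nb_invK permKV.
Qed.

Definition vertex_hom : hom := TreeHom vertex_hom_op.

Lemma app_vertex_hom (i : 'I_l) : on_edges vertex_hom i = val (t (b v i)).
Proof. exact: f_ord. Qed.
Lemma app_vertex_hom_root : on_edges vertex_hom l = val (val v).
Proof. exact: f_root. Qed.

End VertexHom.

Lemma hom_corolla_eq (g h : hom) : on_edges g l = on_edges h l ->
  (forall i : 'I_l, on_edges g i = on_edges h i) -> g = h.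
Proof.
move=> gl gi; apply: tree_homP => x; rewrite corolla_edges leq_eqVlt.
by case/predU1P => [->//|xl]; exact: (gi (Ordinal xl)).
Qed.

Local Notation label := {v : Vert T l & {perm Vert_inputs v}}.
Definition label_hom (p : label) : hom := vertex_hom (tagged p).

Lemma label_hom_inj : injective label_hom.
Proof.
rewrite /label_hom => -[v t] [v' t'] /= E.
have vv' : v = v'.
  by do 2!apply: val_inj; rewrite -(app_vertex_hom_root t) E app_vertex_hom_root.
case: _ / vv' in t' E *; congr existT; apply/permP => x.
rewrite -[x](nb_invK (b v)); apply: val_inj.
by rewrite -!app_vertex_hom E.
Qed.

(** A hull edge strictly above [v] lies between an input of [v] and a tip. The tip is an input too,
    so all three coincide. *)
Lemma label_hom_inner (p : label) : inner_of (label_hom p) = fset0.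
Proof.
case: p => v t; apply/fsetP => x; rewrite innerP [RHS]inE; apply/negP.
move=> /andP[xl /hull_vertP[/hull_edgesP[xT vx [i xi]] ne]].
rewrite /= /label_hom app_vertex_hom_root in xl vx.
have [w wv wx] : exists2 w, w \in inputs T (val (val v)) & anc T w x.
  by apply: anc_input => //; rewrite eq_sym.
have := ne i; rewrite /label_hom app_vertex_hom in xi *.
have iv := valP (t (b v i)).
have iT : val (t (b v i)) \in edges T by have /input_up[] := iv.
have wE := input_eq wv iv (anc_trans wx xi) (anc_refl _ _).
by rewrite (anc_antisym iT xi) ?eqxx // -wE.
Qed.

(** Without inner edges every hull edge but the root is a tip. So each input of the root vertex is a
    tip, and by the antichain property each tip is such an input. *)
Lemma inner0_label_hom (g : hom) : inner_of g = fset0 -> exists p, label_hom p = g.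
Proof.
move=> g0; have rV := hull_root_vert l2 g.
have gi_inj : injective (fun i : 'I_l => on_edges g i).
  by move=> i j ij; apply: (corolla_hom_antichain l2 (g := g)); rewrite ij anc_refl.
have inE1 x : x \in inputs T (on_edges g l) -> exists i : 'I_l, x = on_edges g i.
  rewrite -(hull_inputs l2 rV) inputsP => /and3P[xS xl _].
  apply: contrapT => H; have : x \in inner_of g.
    rewrite innerP xl; apply/hull_vertP; split=> // i.
    by apply/eqP => xi; apply: H; exists i.
  by rewrite g0 inE.
have inE2 (i : 'I_l) : on_edges g i \in inputs T (on_edges g l).
  have /hull_edgesP[iT li _] := hull_tip l2 g i.
  have [|w wl wi] := anc_input iT li.
    by have /hull_vertP[_ ->] := rV.
  have [j wj] := inE1 _ wl; rewrite wj in wl wi.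
  by rewrite -(corolla_hom_antichain l2 wi).
have vT := hull_vert_vert l2 rV.
have cl : #|` inputs T (on_edges g l)| == l.
  have -> : inputs T (on_edges g l) = [fset x in codom (fun i : 'I_l => on_edges g i)].
    apply/fsetP => x; rewrite [RHS]in_fset; apply/idP/idP => [/inE1[i ->]|/codomP[i ->]].
      exact: (codom_f (fun i : 'I_l => on_edges g i)).
    exact: inE2.
  by rewrite card_fseq undup_id ?size_codom ?card_ord // map_inj_uniq ?enum_uniq.
pose v : Vert T l := exist _ [` vT] cl.
(* The permutation that turns the given numbering [b v] into the numbering by [g]. *)
pose t0 (x : Vert_inputs v) : Vert_inputs v := [` inE2 (nb_inv (b v) x)].
have t0_inj : injective t0.
  move=> x y /(congr1 val)/gi_inj; exact: (can_inj (nb_invK (b v))).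
exists (existT _ v (perm t0_inj)); apply: hom_corolla_eq => [|i].
  by rewrite /label_hom app_vertex_hom_root.
by rewrite /label_hom app_vertex_hom permE /= nb_funK.
Qed.

(** Products of permutations apply the left factor first, so precomposition becomes left
    multiplication by [relabel]. *)
Lemma label_hom_act (p : label) (s : {perm 'I_l}) :
  tree_comp (label_hom p) (corolla_aut s) =
  vertex_hom (relabel (b (tag p)) s * tagged p)%g.
Proof.
case: p => v t; rewrite /label_hom /=; apply: hom_corolla_eq => [|i].
  rewrite app_comp ?corolla_edges // app_corolla_perm corolla_perm_root.
  by rewrite !app_vertex_hom_root.
rewrite app_comp ?corolla_edges ?(ltnW (ltn_ord i)) //.
rewrite app_corolla_perm corolla_perm_ord !app_vertex_hom permM permE.
by rewrite nb_funK.
Qed.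

Definition vertex_label (g : hom) : vertex_sum T l :=
  if pselect (exists p, label_hom p = g) is left H then
    @dsum_inj _ (fun v : Vert T l => freeab {perm Vert_inputs v})
      (tag (sval (cid H))) (freeab_gen (tagged (sval (cid H))))
  else 0.

Lemma vertex_label_hom p : vertex_label (label_hom p) =
  @dsum_inj _ (fun v : Vert T l => freeab {perm Vert_inputs v})
    (tag p) (freeab_gen (tagged p)).
Proof.
rewrite /vertex_label; case: pselect => [H|[]]; last by exists p.
by case: (cid H) => q /= /label_hom_inj ->.
Qed.

Lemma vertex_label_out g : ~ (exists p, label_hom p = g) -> vertex_label g = 0.
Proof. by move=> H; rewrite /vertex_label; case: pselect. Qed.

Lemma vertex_sum_act_zmod s : zmod_morphism (@vertex_sum_act T l b s).
Proof.
apply: dsum_lift_zmod => v x y; rewrite -raddfB; congr dsum_inj.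
by rewrite /regular_act dsum_lift_zmod // => t m n; rewrite mulrzBr.
Qed.

Lemma vertex_label_act g s :
  vertex_label (tree_comp g (corolla_aut s)) = vertex_sum_act b s (vertex_label g).
Proof.
have act0 : vertex_sum_act b s 0 = 0.
  by have := vertex_sum_act_zmod s 0 0; rewrite !subrr.
have [[p <-]|H] := pselect (exists p, label_hom p = g).
  rewrite label_hom_act.
  rewrite -[vertex_hom _]/(label_hom
    (existT _ (tag p) (relabel (b (tag p)) s * tagged p)%g)).
  rewrite !vertex_label_hom /= /vertex_sum_act dsum_lift_inj; last first.
    move=> v x y; rewrite -raddfB; congr dsum_inj.
    by rewrite /regular_act dsum_lift_zmod // => t m n; rewrite mulrzBr.
  congr dsum_inj; rewrite /regular_act dsum_lift_inj ?mulr1z //.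
  by move=> t m n; rewrite mulrzBr.
(* If [g] precomposed with [s] comes from a vertex, then so does [g], by acting with the inverse of
   [s]. *)
rewrite !vertex_label_out // => -[p pg]; apply: H.
exists (existT _ (tag p) (relabel (b (tag p)) s^-1 * tagged p)%g).
rewrite [LHS](esym (label_hom_act p s^-1)) pg -tree_compA -[RHS]tree_compm1.
congr tree_comp.
apply: tree_homP => x; rewrite corolla_edges => xl.
rewrite app_id app_comp ?corolla_edges // !app_corolla_perm.
move: xl; rewrite leq_eqVlt => /predU1P[->|xl]; first by rewrite !corolla_perm_root.
rewrite -[x]/(nat_of_ord (Ordinal xl)) !corolla_perm_ord.
by rewrite permKV.
Qed.

(** * Comparison of degree -1 with the sum over vertices *)

Let label_perm (g : hom) (e : 'I_0 -> nat) (t : {perm 'I_0}) :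
  vertex_label g = vertex_label g *~ (-1) ^+ t.
Proof.
have -> : t = 1%g by apply/permP => -[].
by rewrite odd_perm1 mulr1z.
Qed.

Definition to_vertices : DC 0 -> vertex_sum T l :=
  extend (fun g (_ : 'I_0 -> nat) => vertex_label g).
Lemma to_vertices_zmod : zmod_morphism to_vertices.
Proof. exact: extend_zmod label_perm. Qed.
HB.instance Definition _ := GRing.isZmodMorphism.Build _ _ to_vertices to_vertices_zmod.

Lemma to_vertices_chain g e : labelled_cell g e ->
  to_vertices (chain g e) = vertex_label g.
Proof. exact: (extend_chain label_perm). Qed.

Let no_enum (i : 'I_0) : nat := 0%N.

Let no_enumE e : e = no_enum.
Proof. by apply: functional_extensionality_dep => -[]. Qed.

Definition of_vertex (v : Vert T l) : freeab {perm Vert_inputs v} -> DC 0 :=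
  dsum_lift (fun (t : {perm Vert_inputs v}) k => chain (vertex_hom t) no_enum *~ k).
Lemma of_vertex_zmod v : zmod_morphism (@of_vertex v).
Proof. by apply: dsum_lift_zmod => t m n; rewrite mulrzBr. Qed.

Definition of_vertices : vertex_sum T l -> DC 0 := dsum_lift (@of_vertex).
Lemma of_vertices_zmod : zmod_morphism of_vertices.
Proof. exact/dsum_lift_zmod/of_vertex_zmod. Qed.
HB.instance Definition _ v :=
  GRing.isZmodMorphism.Build _ _ (@of_vertex v) (@of_vertex_zmod v).
HB.instance Definition _ := GRing.isZmodMorphism.Build _ _ of_vertices of_vertices_zmod.

Lemma of_vertices_label p :
  of_vertices (vertex_label (label_hom p)) = chain (label_hom p) no_enum.
Proof.
rewrite vertex_label_hom /of_vertices dsum_lift_inj; last exact: of_vertex_zmod.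
by rewrite /of_vertex dsum_lift_inj ?mulr1z // => t m n; rewrite mulrzBr.
Qed.

(** If the hull of [g] has an inner edge, the cone contracts the chain and its label is zero;
    otherwise the cone is zero and the label recovers the chain. *)
Lemma to_verticesK u : DC_d (homotopy l2 u) + of_vertices (to_vertices u) = u.
Proof.
elim/chain_ind: u => [|u v IHu IHv|g e le]; first by rewrite !raddf0 addr0.
  by rewrite !raddfB /= -{3}IHu -{3}IHv addrACA -opprD.
rewrite to_vertices_chain //.
have [g0|g0] := eqVneq (inner_of g) fset0.
  have [p pg] := inner0_label_hom g0.
  rewrite homotopy_chain // /cone chain_out ?raddf0 ?add0r; last first.
    by move=> /labelled_inner - /(_ l2 ord0); rewrite g0 inE.
  by rewrite -pg of_vertices_label (no_enumE e).
rewrite homotopy0 // vertex_label_out ?raddf0 ?addr0 // => -[p pg].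
by move: g0; rewrite -pg label_hom_inner eqxx.
Qed.

(** Faces keep [g], whose hull has an inner edge here, so no face is labelled by a vertex. *)
Lemma to_vertices_d (u : DC 1) : to_vertices (DC_d u) = 0.
Proof.
elim/chain_ind: u => [|u v IHu IHv|g e le]; first by rewrite !raddf0.
  by rewrite !raddfB /= IHu IHv subrr.
rewrite chain_d // raddf_sum big1 // => i _.
rewrite raddfMz /= to_vertices_chain; last exact: (labelled_face i le).
rewrite vertex_label_out ?mul0rz // => -[p pg].
by have := labelled_inner l2 le ord0; rewrite -pg label_hom_inner inE.
Qed.

Lemma of_verticesK : cancel of_vertices to_vertices.
Proof.
move=> w; elim/dsum_ind: w => [|u v IHu IHv|v x]; first by rewrite !raddf0.
  by rewrite !raddfD /= IHu IHv.
elim/dsum_ind: x => [|x y IHx IHy|t k]; first by rewrite !raddf0.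
  by rewrite !raddfD /= IHx IHy.
rewrite freeab_genE !raddfMz /=; congr (_ *~ _).
rewrite -(vertex_label_hom (existT _ v t)) of_vertices_label.
rewrite to_vertices_chain //.
(* Some marked tree realises the label, so the chain is not the default zero. *)
have [||c [f lf]] := @labels_exist T l l2 0 (label_hom (existT _ v t)) no_enum.
- by move=> [].
- by move=> [].
by exists (existT _ c f).
Qed.

Lemma chain_act n (g : hom) (e : 'I_n -> nat) s : labelled_cell g e ->
  DC_act s (chain g e) = chain (tree_comp g (corolla_aut s)) e.
Proof.
move=> [[c f] /= lf].
by rewrite -(chain_class lf) DC_act_class -(chain_class (labels_act s lf)).
Qed.

Lemma to_vertices_act s u : to_vertices (DC_act s u) = vertex_sum_act b s (to_vertices u).
Proof.
pose add := GRing.isZmodMorphism.Build _ _ _ (vertex_sum_act_zmod s).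
pose act : {additive vertex_sum T l -> vertex_sum T l} :=
  HB.pack (vertex_sum_act b s) add.
rewrite -[RHS]/(act (to_vertices u)).
elim/chain_ind: u => [|u v IHu IHv|g e le]; first by rewrite !raddf0.
  by rewrite !raddfB /= IHu IHv.
rewrite chain_act // to_vertices_chain /= ?to_vertices_chain ?vertex_label_act //.
have [[c f] /= lf] := le.
by exists (existT _ (cell_act s c) f); exact: labels_act.
Qed.

(** The target is again [DC 0] because [0.-1] is [0]; the sum over faces is empty. *)
Lemma DC_d0 (u : DC 0) : DC_d u = 0.
Proof.
elim/chain_ind: u => [|u v IHu IHv|g e le]; first by rewrite !raddf0.
  by rewrite !raddfB /= IHu IHv subrr.
by rewrite chain_d // big_ord0.
Qed.

Lemma DC0_cycle (u : DC 0) : u \in dkernel (@DC_d M l 0).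
Proof. apply/eqP; exact: DC_d0. Qed.

Definition cycle_vertices (z : cycles (@DC_d M l 0)) : vertex_sum T l :=
  to_vertices (cycle_val z).
Lemma cycle_vertices_zmod : zmod_morphism cycle_vertices.
Proof. by move=> x y; rewrite /cycle_vertices raddfB. Qed.
HB.instance Definition _ :=
  GRing.isZmodMorphism.Build _ _ cycle_vertices cycle_vertices_zmod.

Lemma cycle_vertices_im z :
  (exists y, @DC_d M l 1 y = cycle_val z) -> cycle_vertices z = 0.
Proof. by move=> [y yz]; rewrite /cycle_vertices -yz to_vertices_d. Qed.

Definition DH_vertices : DH M l 0 -> vertex_sum T l := quot_lift cycle_vertices.
Lemma DH_vertices_zmod : zmod_morphism DH_vertices.
Proof. exact: quot_lift_zmod cycle_vertices_im. Qed.
HB.instance Definition _ := GRing.isZmodMorphism.Build _ _ DH_vertices DH_vertices_zmod.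

Lemma DH_vertices_pi z : DH_vertices (quot_pi _ z) = to_vertices (cycle_val z).
Proof. by rewrite /DH_vertices (quot_lift_pi cycle_vertices_im). Qed.

(** The inverse is induced by [of_vertices]: by [to_verticesK] the round trip changes a cycle by the
    boundary of its homotopy. *)
Lemma DH_vertices_bij : bijective DH_vertices.
Proof.
exists (fun w => quot_pi _ (Cycle (DC0_cycle (of_vertices w)))) => [x|w]; last first.
  by rewrite DH_vertices_pi /= of_verticesK.
have [z ->] := quot_piP x; rewrite DH_vertices_pi.
apply/eqP; rewrite eq_sym -subr_eq0 -raddfB; apply/eqP/quot_pi_rel.
exists (homotopy l2 (cycle_val z)).
rewrite [RHS](_ : _ = cycle_val z - of_vertices (to_vertices (cycle_val z))) //.
by rewrite -{2}(to_verticesK (cycle_val z)) addrK.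
Qed.

Lemma DH_vertices_act s x :
  DH_vertices (DH_act s x) = vertex_sum_act b s (DH_vertices x).
Proof.
have [z ->] := quot_piP x; rewrite DH_vertices_pi -to_vertices_act.
rewrite /DH_act /homology_map quot_lift_pi; last first.
  move=> z' [y yz]; apply: quot_pi_rel; exists (DC_act s y).
  by rewrite /= -yz (@DC_act_d _ _ _ 1).
by rewrite [LHS]DH_vertices_pi.
Qed.

Lemma DH_vertices_iso : exists2 phi : {additive DH M l 0 -> vertex_sum T l},
  bijective phi &
  forall (s : {perm 'I_l}) x, phi (DH_act s x) = vertex_sum_act b s (phi x).
Proof. by exists DH_vertices; [exact: DH_vertices_bij|exact: DH_vertices_act]. Qed.

End Corollas.

(** By [homotopyS] a cycle is the boundary of its image under the homotopy. *)
Lemma DH_positive (T : rtree) (l n : nat) (l2 : (2 <= l)%N)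
  (x : DH (restrict_A (free_presheaf (@representable Omega_r T))) l n.+1) : x = 0.
Proof.
have [z ->] := quot_piP x; apply: quot_pi_rel.
exists (homotopy l2 (cycle_val z)).
have /eqP dz : DC_d (cycle_val z) == 0 by case: z {x} => z /=; rewrite inE.
by rewrite -[RHS](homotopyS l2) dz raddf0 addr0.
Qed.

(* [DH M l n] is the component of arity l of dendroidal homology in degree
   p = n - 1. *)
Theorem corollary3p6 (T : rtree) (l : nat) (hl : (2 <= l)%N) :
  let M := restrict_A (free_presheaf (@representable Omega_r T)) in
  (forall b : (forall v : Vert T l, numbering l (Vert_inputs v)),
     exists2 phi : {additive DH M l 0 -> vertex_sum T l}, bijective phi &
       forall (s : {perm 'I_l}) (x : DH M l 0),
         phi (DH_act s x) = vertex_sum_act b s (phi x)) /\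
  (forall n : nat, (0 < n)%N -> forall x : DH M l n, x = 0).
Proof.
move=> M; split=> [b|[//|n] _ x]; last exact: (DH_positive hl).
exact: DH_vertices_iso.
Qed.
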